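(* Let $QS$ be the quadrilateral set matroid. Its matroid ideal $I_{QS}\subseteq \mathbb{C}[x_1,y_1,z_1,\dots,x_6,y_6,z_6]$ is minimally generated as $$I_{QS}=\big\langle [123]_X,\ [156]_X,\ [246]_X,\ [345]_X,\ QS(\ell_{123};R_i,R_j,R_k)\ \text{ for all } i\le j\le k \text{ with } i,j,k\in\{1,2,3\}\big\rangle,$$ that is, the ideal equals $I_{QS}$ and none of the listed generators lies in the ideal generated by the others.
   Context: $QS$ is the simple rank-$3$ matroid on $[6]$ whose circuits are the inclusion-minimal elements of $\Delta\cup\binom{[6]}{4}$, where $\Delta=\{\{1,2,3\},\{1,5,6\},\{2,4,6\},\{3,4,5\}\}$. Let $X$ be the $3\times 6$ matrix of variables whose $j$-th column is $(x_j,y_j,z_j)^t$; the symbol $j$ also denotes this column. $[abc]_X$ is the determinant of the $3\times3$ matrix with columns $a,b,c$ of $X$, and for a vector $R$, $[a\,b\,R]$ is the determinant of the matrix with columns $a,b,R$. Coordinates are taken with respect to the frame of reference $\{R_1,R_2,R_3,U\}$ of $\mathbb{P}^2_{\mathbb{C}}$, so $R_1=(1,0,0)^t$, $R_2=(0,1,0)^t$, $R_3=(0,0,1)^t$. The polynomials are $$QS(\ell_{123};R_i,R_j,R_k)=[1\,5\,R_i][2\,6\,R_j][3\,4\,R_k]-[1\,6\,R_i][2\,4\,R_j][3\,5\,R_k].$$ The matroid variety $V_{QS}$ is the Zariski closure in $\mathbb{C}^{3\times6}$ of the set of matrices for which a set of columns is linearly independent iff its index set is independent in $QS$; $I_{QS}=I(V_{QS})$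 is its vanishing ideal. *)

(* Defs.v *)
From HB Require Import structures.
From mathcomp Require Import all_boot all_order all_algebra.
From mathcomp Require Import reals complex mpoly.

Set Implicit Arguments.
Unset Strict Implicit.
Unset Printing Implicit Defensive.

Import GRing.Theory.
Local Open Scope ring_scope.

(* The labels 1, ..., 6 are the ordinals 0, ..., 5. *)
Definition pt (k : nat) : 'I_6 := inord k.-1.

Definition QS_lines : {set {set 'I_6}} :=
  [set [set pt 1; pt 2; pt 3]; [set pt 1; pt 5; pt 6];
       [set pt 2; pt 4; pt 6]; [set pt 3; pt 4; pt 5]].

Definition QS_circuits : {set {set 'I_6}} :=
  [set C | minset (fun D : {set 'I_6} => (D \in QS_lines) || (#|D| == 4)%N) C].

Definition QS_indep (S : {set 'I_6}) : bool :=
  [forall C in QS_circuits, ~~ (C \subset S)].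

Section Ideals.

Variable P : comNzRingType.

Definition ideal_span (s : seq P) (p : P) : Prop :=
  exists c : nat -> P, p = \sum_(i < size s) c i * s`_i.

(* Removal is by position, so a repeated generator counts as redundant. *)
Definition remove_nth (i : nat) (s : seq P) : seq P := take i s ++ drop i.+1 s.

End Ideals.

Section MatroidIdeal.

Variables (K : fieldType) (m n : nat).

(* The variable of entry (i, j) has index mxvec_index i j, so the columns of the
   matrix of variables for m = 3, n = 6 are (x_j, y_j, z_j)^t. *)
Definition var_mx : 'M[{mpoly K[m * n]}]_(m, n) :=
  \matrix_(i, j) 'X_(mxvec_index i j).

Definition eval_mx (A : 'M[K]_(m, n)) (p : {mpoly K[m * n]}) : K :=
  p.@[mxvec A 0].

Definition zero_locus (F : {mpoly K[m * n]} -> Prop) (A : 'M[K]_(m, n)) : Prop :=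
  forall p, F p -> eval_mx A p = 0.

Definition vanishing_ideal (V : 'M[K]_(m, n) -> Prop) (p : {mpoly K[m * n]}) :
    Prop :=
  forall A, V A -> eval_mx A p = 0.

(* Intersection of all algebraic sets containing V. *)
Definition zariski_closure (V : 'M[K]_(m, n) -> Prop) (A : 'M[K]_(m, n)) : Prop :=
  forall F : {mpoly K[m * n]} -> Prop,
    (forall B, V B -> zero_locus F B) -> zero_locus F A.

(* [free] is applied to the family of columns, so two equal columns with
   distinct indices are dependent. *)
Definition realizes (indep : {set 'I_n} -> bool) (A : 'M[K]_(m, n)) : Prop :=
  forall S : {set 'I_n}, free [seq col j A | j <- enum S] = indep S.

Definition matroid_variety (indep : {set 'I_n} -> bool) : 'M[K]_(m, n) -> Prop :=
  zariski_closure (realizes indep).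

Definition matroid_ideal (indep : {set 'I_n} -> bool) : {mpoly K[m * n]} -> Prop :=
  vanishing_ideal (matroid_variety indep).

End MatroidIdeal.

Section QuadrilateralSet.

Variable K : fieldType.

Local Notation P := {mpoly K[3 * 6]}.

Definition bracket (u v w : 'cV[P]_3) : P :=
  \det (\matrix_(i < 3, j < 3) [:: u; v; w]`_j i 0).

Definition X_col (k : nat) : 'cV[P]_3 := col (pt k) (var_mx K 3 6).

Definition ref_pt (i : 'I_3) : 'cV[P]_3 := delta_mx i 0.

Definition bracketX (a b c : nat) : P := bracket (X_col a) (X_col b) (X_col c).

Definition bracketR (a b : nat) (i : 'I_3) : P :=
  bracket (X_col a) (X_col b) (ref_pt i).

Definition QS_poly (i j k : 'I_3) : P :=
  bracketR 1 5 i * bracketR 2 6 j * bracketR 3 4 k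
  - bracketR 1 6 i * bracketR 2 4 j * bracketR 3 5 k.

Definition QS_generators : seq P :=
  [:: bracketX 1 2 3; bracketX 1 5 6; bracketX 2 4 6; bracketX 3 4 5]
  ++ [seq QS_poly t.1.1 t.1.2 t.2
     | t : 'I_3 * 'I_3 * 'I_3 <- enum {: 'I_3 * 'I_3 * 'I_3} & (t.1.1 <= t.1.2 <= t.2)%N].

End QuadrilateralSet.

(* Main.v *)
(* The four brackets [123], [156], [246], [345] generate a complete intersection CI.
   Points with 4, 5, 1 independent that satisfy the four equations are, up to the
   closure, quadrilateral sets: in the frame 4, 5, 1 the equations become binomials
   b beta = c alpha and a zeta = b eps, whose leading monomials c alpha and a zeta are
   coprime to b, and inverting b they parametrize the variety. Hence some power of
   the bracket [4 5 1] multiplies I_QS into CI, and by symmetry so do the brackets of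
   the 12 triples which are the images of {4, 5, 1} under the automorphisms of QS.

   For a suitable weight order the four brackets have pairwise coprime squarefree
   leading monomials, so they are a Groebner basis of CI. If p is in I_QS, then
   lead(p) times a power of each of the 12 squarefree leading monomials above lies in
   in(CI); the colon of in(CI) by these 12 monomials is generated by in(CI) and by the
   leading monomials of ten of the QS(l_123; R_i, R_j, R_k) (not all with i <= j <= k,
   but permuting the indices changes these polynomials by elements of CI only).
   So the four brackets and these ten polynomials form a Groebner basis of I_QS.

   Minimality: for a bracket, evaluate at a matrix in which the three columns of the
   line are the standard basis and the others vanish. For QS_ijk, restrict to matrices
   of rank 2: there the brackets vanish and QS_ijk becomes w_i w_j w_k times a scalar,
   where w is the vector of Pluecker coordinates of the column space. *)
From HB Require Import structures.
Require Import Defs.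
From mathcomp Require Import all_boot all_order all_algebra.
From mathcomp Require Import reals complex mpoly.
From mathcomp Require Import ring.

Set Implicit Arguments.
Unset Strict Implicit.
Unset Printing Implicit Defensive.

Import Order.TTheory GRing.Theory Num.Theory.
Local Open Scope ring_scope.

(** * Ideals and leading monomials *)

Section IdealSpan.

Variable P : comNzRingType.
Implicit Types (s : seq P) (p q : P).

Lemma ideal_span_cons g s p :
  ideal_span (g :: s) p <-> exists c q, ideal_span s q /\ p = c * g + q.
Proof.
split=> [[c ->]|[c [q [[d ->] ->]]]].
  exists (c 0%N), (\sum_(i < size s) c i.+1 * s`_i).
  by rewrite big_ord_recl; split=> //; exists (fun i => c i.+1).
by exists (fun i => if i is j.+1 then d j else c); rewrite /= big_ord_recl.
Qed.

Lemma ideal_span0 s : ideal_span s 0.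
Proof. by exists (fun=> 0); rewrite big1 // => i _; rewrite mul0r. Qed.

Lemma ideal_spanD s p q : ideal_span s p -> ideal_span s q -> ideal_span s (p + q).
Proof.
move=> [c ->] [d ->]; exists (fun i => c i + d i).
by rewrite -big_split; apply: eq_bigr => i _; rewrite mulrDl.
Qed.

Lemma ideal_spanM s p q : ideal_span s q -> ideal_span s (p * q).
Proof.
move=> [c ->]; exists (fun i => p * c i).
by rewrite mulr_sumr; apply: eq_bigr => i _; rewrite mulrA.
Qed.

Lemma ideal_spanN s p : ideal_span s p -> ideal_span s (- p).
Proof. by rewrite -mulN1r; apply: ideal_spanM. Qed.

Lemma ideal_spanB s p q : ideal_span s p -> ideal_span s q -> ideal_span s (p - q).
Proof. by move=> sp sq; apply/ideal_spanD/ideal_spanN. Qed.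

Lemma mem_ideal_span s p : p \in s -> ideal_span s p.
Proof.
elim: s => // g s IHs; rewrite inE => /predU1P[->|/IHs sp]; apply/ideal_span_cons.
  by exists 1, 0; split; [apply: ideal_span0 | rewrite mul1r addr0].
by exists 0, p; rewrite mul0r add0r.
Qed.

Lemma ideal_span_ind s (I : P -> Prop) :
    I 0 -> (forall p q, I p -> I q -> I (p + q)) -> (forall p q, I q -> I (p * q)) ->
    (forall p, p \in s -> I p) ->
  forall p, ideal_span s p -> I p.
Proof.
move=> I0 ID IM Is p [c ->]; apply: (big_ind I) => // i _.
by apply/IM/Is/mem_nth.
Qed.

Lemma sub_ideal_span s s' :
  (forall p, p \in s -> ideal_span s' p) ->
  forall p, ideal_span s p -> ideal_span s' p.
Proof.
apply: ideal_span_ind; [apply: ideal_span0 | |] => p q.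
  exact: ideal_spanD.
exact: ideal_spanM.
Qed.

End IdealSpan.

(** * Leading monomials for a weighted order *)

Section WeightedOrder.

Variables (K : fieldType) (n : nat) (w : 'I_n -> nat).
Hypothesis w_gt0 : forall i, (0 < w i)%N.

Local Notation P := {mpoly K[n]}.
Implicit Types (m : 'X_{1..n}) (p q f g : P).

Definition wmonom m : 'X_{1..n} := [multinom (w i * m i)%N | i < n].

Definition wdeg m : nat := mdeg (wmonom m).

(* Substituting 'X_i ^+ w i turns the monomial order of the library into the one
   that compares weighted degrees first. *)
Definition wscale p : P := p \mPo [tuple 'X_i ^+ w i | i < n].

(** Weighted degrees are compared first, ties by the library order on the scaled exponents.
    Nonzeroness is demanded because [mlead 0] is the default [0]. *)
Definition leads p m : bool := (p != 0) && (mlead (wscale p) == wmonom m).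

Lemma wmonom_inj : injective wmonom.
Proof.
move=> m m' /mnmP eq_mm'; apply/mnmP => i.
by have /eqP := eq_mm' i; rewrite !mnmE eqn_pmul2l // => /eqP.
Qed.

Lemma wmonomD m m' : wmonom (m + m') = (wmonom m + wmonom m')%MM.
Proof. by apply/mnmP => i; rewrite !mnmE mulnDr. Qed.

Lemma wmonomMn m k : wmonom (m *+ k) = (wmonom m *+ k)%MM.
Proof. by apply/mnmP => i; rewrite !(mnmE, mulmnE) mulnA. Qed.

Lemma wdegD m m' : wdeg (m + m') = (wdeg m + wdeg m')%N.
Proof. by rewrite /wdeg wmonomD mdegD. Qed.

Lemma wdeg0 : wdeg 0 = 0%N.
Proof. by rewrite /wdeg mdegE big1 // => i _; rewrite !mnmE muln0. Qed.

Lemma wdegU i : wdeg U_(i) = w i.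
Proof.
rewrite /wdeg mdegE (bigD1 i) //= big1 ?addn0 => [|j ji]; rewrite !mnmE.
  by rewrite eqxx muln1.
by rewrite eq_sym (negPf ji) muln0.
Qed.

Lemma wscaleX m : wscale 'X_[m] = 'X_[wmonom m].
Proof.
rewrite /wscale comp_mpolyX [RHS]mpolyXE_id; apply: eq_bigr => i _.
by rewrite tnth_mktuple mnmE exprM.
Qed.

Lemma wscaleE p : wscale p = \sum_(m <- msupp p) p@_m *: 'X_[wmonom m].
Proof.
rewrite {1}[p]mpolyE /wscale raddf_sum /=; apply: eq_bigr => m _.
by rewrite comp_mpolyZ -/(wscale _) wscaleX.
Qed.

Lemma mcoeff_wscale p m : (wscale p)@_(wmonom m) = p@_m.
Proof.
rewrite wscaleE raddf_sum /=; under eq_bigr do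
  rewrite mcoeffZ mcoeffX (inj_eq wmonom_inj).
have [m_p|m_p] := boolP (m \in msupp p); last first.
  rewrite memN_msupp_eq0 // big1_seq // => m' /= m'_p.
  by rewrite (negPf (memPn m_p _ m'_p)) mulr0.
rewrite (bigD1_seq m) ?msupp_uniq //= eqxx mulr1 big1 ?addr0 // => m' /negPf->.
by rewrite mulr0.
Qed.

Lemma msupp_wscale p m : m \in msupp (wscale p) ->
  exists2 m', m' \in msupp p & m = wmonom m'.
Proof.
move=> m_p; have : m \in [seq wmonom m' | m' <- msupp p].
  apply: contraT => m_n; move: m_p; rewrite mcoeff_msupp => /eqP[].
  rewrite wscaleE raddf_sum big1_seq //= => m' m'_p.
  rewrite mcoeffZ mcoeffX; case: eqP m_n => [<-|_ _]; last by rewrite mulr0.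
  by rewrite map_f.
by case/mapP=> m' m'_p ->; exists m'.
Qed.

Lemma wscale_eq0 p : (wscale p == 0) = (p == 0).
Proof.
apply/eqP/eqP => [p0|->]; last by rewrite /wscale raddf0.
by apply/mpolyP => m; rewrite -mcoeff_wscale p0 !mcoeff0.
Qed.

Lemma leads_neq0 p m : leads p m -> p != 0.
Proof. by case/andP. Qed.

Lemma leads_ex p : p != 0 -> exists m, leads p m.
Proof.
move=> p0; have : wscale p != 0 by rewrite wscale_eq0.
by case/mlead_supp/msupp_wscale=> // m _ pm; exists m; rewrite /leads p0 pm eqxx.
Qed.

Lemma leads_uniq p m m' : leads p m -> leads p m' -> m = m'.
Proof. by case/andP=> _ /eqP pm /andP[_]; rewrite pm => /eqP/wmonom_inj. Qed.

Lemma leads_coeff p m : leads p m -> p@_m != 0.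
Proof.
case/andP=> p0 /eqP pm; rewrite -mcoeff_wscale -pm mleadc_eq0.
by rewrite wscale_eq0.
Qed.

Lemma leadsX m : leads 'X_[m] m.
Proof. by rewrite /leads -msupp_eq0 msuppX wscaleX mleadXm /=. Qed.

Lemma leadsM p q m m' : leads p m -> leads q m' -> leads (p * q) (m + m').
Proof.
case/andP=> p0 /eqP pm /andP[q0 /eqP qm]; rewrite /leads mulf_neq0 //= /wscale.
by rewrite rmorphM mleadM ?wscale_eq0 // -!/(wscale _) pm qm wmonomD.
Qed.

Lemma leadsXn p m k : leads p m -> leads (p ^+ k) (m *+ k).
Proof.
case/andP=> p0 /eqP pm; rewrite /leads expf_neq0 //= /wscale.
by rewrite rmorphXn mleadX ?wscale_eq0 // -/(wscale _) pm wmonomMn.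
Qed.

(** Only strict comparisons of weighted degree are asked for, so the tie-breaking order never has to
    be computed. *)
Lemma leadsP p m : p@_m != 0 ->
  (forall m', m' \in msupp p -> m' = m \/ (wdeg m' < wdeg m)%N) -> leads p m.
Proof.
move=> pm max_m; have p0 : p != 0 by apply: contraNneq pm => ->; rewrite mcoeff0.
rewrite /leads p0 /=; apply/eqP/le_anti/andP; split; last first.
  by apply: msupp_le_mlead; rewrite mcoeff_msupp mcoeff_wscale.
have : wscale p != 0 by rewrite wscale_eq0.
case/mlead_supp/msupp_wscale => m' /max_m[->|lt_m] -> //.
exact/ltW/lt_mdeg_ltmc.
Qed.

(** Distinct leading monomials cannot cancel, so the larger one survives in the sum. *)
Lemma leadsD p q m m' : leads p m -> leads q m' -> m != m' ->
  leads (p + q) m || leads (p + q) m'.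
Proof.
case/andP=> p0 /eqP pm /andP[q0 /eqP qm] mm'.
have neq : mlead (wscale p) != mlead (wscale q).
  by rewrite pm qm (inj_eq wmonom_inj).
have spq : wscale (p + q) = wscale p + wscale q by rewrite /wscale raddfD.
have : mlead (wscale (p + q)) = Order.max (wmonom m) (wmonom m').
  by rewrite spq mleadD // pm qm.
have pq0 : p + q != 0.
  rewrite addr_eq0; apply: contraNneq neq => ->.
  by rewrite /wscale raddfN mleadN.
by rewrite /leads pq0 /=; case: leP => _ -> ; rewrite eqxx ?orbT.
Qed.

(** One division step: [c] is the quotient of the leading coefficients, so the leading terms
    cancel. *)
Lemma leads_reduce f g m d : leads f (d + m) -> leads g m ->
  exists2 c, f - c *: 'X_[d] * g = 0 \/
    (mlead (wscale (f - c *: 'X_[d] * g)) < mlead (wscale f))%O & c != 0.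
Proof.
move=> fm gm; have f0 := leads_coeff fm; have g0 := leads_coeff gm.
exists (f@_(d + m) / g@_m); last by rewrite mulf_neq0 ?invr_eq0.
set c := _ / _; have c0 : c != 0 by rewrite mulf_neq0 ?invr_eq0.
set h := c *: _ * _; have hm : leads h (d + m).
  apply: leadsM gm; rewrite /leads scaler_eq0 negb_or c0 (leads_neq0 (leadsX d)).
  by rewrite /wscale comp_mpolyZ -/(wscale _) mleadZ // wscaleX mleadXm /=.
have [->|fh0] := eqVneq (f - h) 0; [by left | right].
have le_fh : (mlead (wscale (f - h)) <= wmonom (d + m))%O.
  have -> : wscale (f - h) = wscale f - wscale h by rewrite /wscale raddfB.
  apply: le_trans (mleadB_le _ _) _.
  by case/andP: fm => _ /eqP->; case/andP: hm => _ /eqP->; rewrite joinxx.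
case/andP: (fm) => _ /eqP->; rewrite lt_neqAle le_fh andbT.
(* If the leading monomial were unchanged, its coefficient in [f - h] would be nonzero, but the
   choice of [c] makes it zero. *)
apply: contraNneq fh0 => lead_fh; rewrite -wscale_eq0 -mleadc_eq0 lead_fh.
rewrite mcoeff_wscale mcoeffB /h -scalerAl mcoeffZ ['X_[d] * g]mulrC mcoeffMX.
by rewrite divfK // subrr.
Qed.

Definition mcoprime m m' := [forall i, (m i == 0%N) || (m' i == 0%N)].

Lemma mcoprime_dvd a b c : mcoprime a b -> (a <= b + c)%MM -> (a <= c)%MM.
Proof.
move=> /forallP ab /mnm_lepP abc; apply/mnm_lepP => i.
by have := abc i; rewrite mnmDE; case/orP: (ab i) => /eqP->.
Qed.

Lemma mcoprimeMn a b k : mcoprime a b -> mcoprime a (b *+ k)%MM.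
Proof.
move=> /forallP ab; apply/forallP=> i; rewrite mulmnE.
by case/orP: (ab i) => /eqP->; rewrite ?mul0n ?eqxx ?orbT.
Qed.

(** * Division and pairwise coprime leading monomials *)

Section CoprimeLeads.

Implicit Type gs : seq (P * 'X_{1..n}).

Definition has_lead_dvd gs m := has (fun t => t.2 <= m)%MM gs.

Lemma normal_form gs f : all (fun t => leads t.1 t.2) gs ->
  exists f', ideal_span (unzip1 gs) (f - f') /\
    (f' = 0 \/ exists2 m, leads f' m & ~~ has_lead_dvd gs m).
Proof.
move=> /allP gsP; move: {2}(mlead _) (erefl (mlead (wscale f))) => mu.
elim/(@ltmwf n): mu f => mu IHmu f fmu.
have [->|f0] := eqVneq f 0.
  by exists 0; rewrite subrr; split; [apply: ideal_span0 | left].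
have [m fm] := leads_ex f0.
have [/hasP[[g mg] /= g_gs mg_m]|] := boolP (has_lead_dvd gs m); last first.
  by exists f; rewrite subrr; split; [apply: ideal_span0 | right; exists m].
have gP : leads g mg := gsP _ g_gs.
have g_in : ideal_span (unzip1 gs) g.
  by apply: mem_ideal_span; apply/mapP; exists (g, mg).
have fm' : leads f (m - mg + mg) by rewrite submK.
have [c + _] := leads_reduce fm' gP; set h := c *: _ * _.
have h_in : ideal_span (unzip1 gs) h by apply: ideal_spanM.
case=> [fh0|].
  by exists 0; rewrite subr0; split; [rewrite -(subrK h f) fh0 add0r | left].
rewrite fmu => /IHmu/(_ _ erefl)[f' [ff' nf']]; exists f'; split=> //.
by rewrite -(subrK h f) addrAC; apply: ideal_spanD.
Qed.

(* Buchberger's first criterion: elements with pairwise coprime leading monomials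
   form a Groebner basis. *)
Lemma coprime_leads_dvd gs f m :
    all (fun t => leads t.1 t.2) gs -> pairwise mcoprime (unzip2 gs) ->
  ideal_span (unzip1 gs) f -> leads f m -> has_lead_dvd gs m.
Proof.
elim: gs f m => [|[g mg] gs IHgs] f m /=.
  by move=> _ _ [c ->]; rewrite big_ord0 /leads eqxx.
move=> /andP[/= gP gsP] /andP[/allP cop_g cop_gs] /ideal_span_cons[c [q [q_in ->]]].
(* With [c'] a normal form of [c] modulo [gs], no lead of [gs] divides that of [c'], hence by
   coprimality with [mg] none divides that of [c' * g]. So the leads of [c' * g] and of the tail
   [q'] differ and cannot cancel. *)
have [c' [cc' nf_c']] := normal_form c gsP.
have -> : c * g + q = c' * g + ((c - c') * g + q) by rewrite addrA -mulrDl subrKC.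
set q' := _ + q; have q'_in : ideal_span (unzip1 gs) q'.
  by apply: ideal_spanD => //; rewrite mulrC; apply: ideal_spanM.
case: nf_c' => [->|[mc c'P nf_mc]]; first by rewrite mul0r add0r => /IHgs->//; rewrite orbT.
have c'gP := leadsM c'P gP.
have mc_n : ~~ has_lead_dvd gs (mc + mg).
  apply: contra nf_mc => /hasP[[h mh] h_gs /= mh_le]; apply/hasP; exists (h, mh) => //=.
  apply: mcoprime_dvd (_ : (mh <= mg + mc)%MM); last by rewrite addmC.
  have /cop_g : mh \in unzip2 gs by apply/mapP; exists (h, mh).
  by move=> /forallP cop; apply/forallP=> i; rewrite orbC.
have [->|q'0] := eqVneq q' 0.
  by rewrite addr0 => /leads_uniq/(_ c'gP)->; rewrite lem_addl.
have [mq q'P] := leads_ex q'0.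
have mq_dvd := IHgs _ _ gsP cop_gs q'_in q'P.
have neq : (mc + mg)%MM != mq by apply: contraNneq mc_n => ->.
have /orP[] := leadsD c'gP q'P neq => /leads_uniq H /H <-.
  by rewrite lem_addl.
by rewrite -/(has_lead_dvd gs mq) mq_dvd orbT.
Qed.

Lemma coprime_leads_dvdXM gs s ms f m N :
    all (fun t => leads t.1 t.2) gs -> pairwise mcoprime (unzip2 gs) ->
    leads s ms -> leads f m -> ideal_span (unzip1 gs) (s ^+ N * f) ->
  has_lead_dvd gs (ms *+ N + m).
Proof.
move=> gsP cop_gs sP fP sf_in.
exact: (coprime_leads_dvd gsP cop_gs sf_in (leadsM (leadsXn N sP) fP)).
Qed.

(** An element whose lead is coprime to those of the basis is a nonzerodivisor modulo the ideal: a
    lead of [gs] dividing [ms *+ N + m] already divides [m], which is impossible for a normal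
    form. *)
Lemma coprime_leads_regular gs s ms f N :
    all (fun t => leads t.1 t.2) gs -> pairwise mcoprime (unzip2 gs) ->
    leads s ms -> all (fun t => mcoprime t.2 ms) gs ->
  ideal_span (unzip1 gs) (s ^+ N * f) -> ideal_span (unzip1 gs) f.
Proof.
move=> gsP cop_gs sP /allP cop_s sf_in; have [f' [ff' nf']] := normal_form f gsP.
suff f'0 : f' = 0 by rewrite -(subr0 f) -f'0.
case: nf' => // -[m f'P nf_m].
have : ideal_span (unzip1 gs) (s ^+ N * f').
  rewrite -[f'](subKr f) mulrBr; apply: ideal_spanB => //; exact: ideal_spanM.
move=> /(coprime_leads_dvdXM gsP cop_gs sP f'P).
case/hasP=> -[g mg] g_gs /= mg_dvd; case/negP: nf_m; apply/hasP; exists (g, mg) => //=.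
by apply: mcoprime_dvd mg_dvd; apply/mcoprimeMn/(cop_s _ g_gs).
Qed.

End CoprimeLeads.

End WeightedOrder.

(** * Brackets as polynomials in the entries *)

Section Coordinates.

Variable S : comNzRingType.
Implicit Type Y : 'M[S]_(3, 6).

(** Rows are counted from 0 and labels from 1. *)
Definition ent Y (i k : nat) : S := Y (inord i) (pt k).

Lemma ent_ord Y (i : 'I_3) (j : 'I_6) : ent Y i j.+1 = Y i j.
Proof. by rewrite /ent /pt !inord_val. Qed.

Definition det3 Y a b c : S :=
  ent Y 0 a * (ent Y 1 b * ent Y 2 c - ent Y 2 b * ent Y 1 c)
  - ent Y 0 b * (ent Y 1 a * ent Y 2 c - ent Y 2 a * ent Y 1 c)
  + ent Y 0 c * (ent Y 1 a * ent Y 2 b - ent Y 2 a * ent Y 1 b).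

(** Coordinate [i] of the cross product of the columns [a] and [b], with rows taken cyclically; it
    equals the bracket of [a], [b] and the reference point of index [i]. *)
Definition cross Y a b (i : nat) : S :=
  ent Y (i.+1 %% 3) a * ent Y (i.+2 %% 3) b
  - ent Y (i.+2 %% 3) a * ent Y (i.+1 %% 3) b.

Definition qs Y i j k : S :=
  cross Y 1 5 i * cross Y 2 6 j * cross Y 3 4 k
  - cross Y 1 6 i * cross Y 2 4 j * cross Y 3 5 k.

Lemma det_col3 (u v w : 'cV[S]_3) :
  \det (\matrix_(i < 3, j < 3) [:: u; v; w]`_j i 0) =
  u (inord 0) 0 * (v (inord 1) 0 * w (inord 2) 0 - v (inord 2) 0 * w (inord 1) 0)
  - v (inord 0) 0 * (u (inord 1) 0 * w (inord 2) 0 - u (inord 2) 0 * w (inord 1) 0)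
  + w (inord 0) 0 * (u (inord 1) 0 * v (inord 2) 0 - u (inord 2) 0 * v (inord 1) 0).
Proof.
have e0 : inord 0 = ord0 :> 'I_3 by apply/val_inj; rewrite /= inordK.
have e1 : inord 1 = lift ord0 ord0 :> 'I_3 by apply/val_inj; rewrite /= inordK.
have e2 : inord 2 = lift ord0 (lift ord0 ord0) :> 'I_3.
  by apply/val_inj; rewrite /= inordK.
rewrite e0 e1 e2 (expand_det_row _ ord0) !big_ord_recl big_ord0 /cofactor.
rewrite !(expand_det_row _ ord0) !big_ord_recl !big_ord0 /cofactor !det_mx11.
rewrite !mxE /= /bump /=; ring.
Qed.

End Coordinates.

Section Morphism.

Variables (S S' : comNzRingType) (f : {rmorphism S -> S'}) (Y : 'M[S]_(3, 6)).

Lemma ent_map i k : ent (map_mx f Y) i k = f (ent Y i k).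
Proof. by rewrite /ent mxE. Qed.

Lemma det3_map a b c : det3 (map_mx f Y) a b c = f (det3 Y a b c).
Proof. by rewrite /det3 !ent_map !(rmorphB, rmorphD, rmorphM). Qed.

Lemma cross_map a b i : cross (map_mx f Y) a b i = f (cross Y a b i).
Proof. by rewrite /cross rmorphB !rmorphM !ent_map. Qed.

Lemma qs_map i j k : qs (map_mx f Y) i j k = f (qs Y i j k).
Proof. by rewrite /qs rmorphB !rmorphM !cross_map. Qed.

End Morphism.


Section Substitution.

Variables (K : fieldType) (S : comNzRingType) (kappa : {rmorphism K -> S}).

Local Notation P := {mpoly K[3 * 6]}.
Local Notation X := (var_mx K 3 6).

Definition subst (Y : 'M[S]_(3, 6)) (p : P) : S := mmap kappa (mxvec Y 0) p.

HB.instance Definition _ Y := GRing.RMorphism.copy (subst Y) (mmap kappa (mxvec Y 0)).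

Lemma subst_var_mx Y : map_mx (subst Y) X = Y.
Proof. by apply/matrixP => i j; rewrite !mxE /subst mmapX mmap1U mxvecE. Qed.

Lemma subst_ent Y i k : subst Y (ent X i k) = ent Y i k.
Proof. by rewrite -ent_map subst_var_mx. Qed.

Lemma subst_det3 Y a b c : subst Y (det3 X a b c) = det3 Y a b c.
Proof. by rewrite -det3_map subst_var_mx. Qed.

Lemma subst_qs Y i j k : subst Y (qs X i j k) = qs Y i j k.
Proof. by rewrite -qs_map subst_var_mx. Qed.

Lemma substC Y c : subst Y c%:MP = kappa c.
Proof. exact: mmapC. Qed.

Lemma substD Y p q : subst Y (p + q) = subst Y p + subst Y q.
Proof. exact: rmorphD. Qed.

Lemma substM Y p q : subst Y (p * q) = subst Y p * subst Y q.
Proof. exact: rmorphM. Qed.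

Lemma substXn Y p n : subst Y (p ^+ n) = subst Y p ^+ n.
Proof. exact: rmorphXn. Qed.

Lemma substX Y i k : subst Y 'X_(mxvec_index i k) = Y i k.
Proof. by rewrite /subst mmapX mmap1U mxvecE. Qed.

End Substitution.

Section Brackets.

Variable K : fieldType.
Local Notation X := (var_mx K 3 6).

Lemma X_colE a i : X_col K a (inord i) 0 = ent X i a.
Proof. by rewrite [LHS]mxE. Qed.

Lemma bracketXE a b c : bracketX K a b c = det3 X a b c.
Proof. by rewrite /bracketX /bracket det_col3 !X_colE. Qed.

Lemma bracketRE a b (i : 'I_3) : bracketR K a b i = cross X a b i.
Proof.
have refE k : (k < 3)%N -> ref_pt K i (inord k) 0 = (k == i :> nat)%:R.
  by move=> lt_k3; rewrite mxE andbT -val_eqE /= inordK.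
rewrite /bracketR /bracket det_col3 !X_colE !refE // /cross.
by case: i {refE} => -[|[|[|//]]] /= _; ring.
Qed.

Lemma QS_polyE (i j k : 'I_3) : QS_poly K i j k = qs X i j k.
Proof. by rewrite /QS_poly !bracketRE. Qed.

End Brackets.

(* Polynomials as lists of signed words in the positions (row, label), so that leading
   monomials can be checked by computation. *)
Section SignedWords.

(** The sign [true] stands for minus. *)
Definition term := (bool * seq (nat * nat))%type.
Implicit Types (L : seq term) (l u : seq (nat * nat)) (T : seq (seq nat)).

Definition in_range l := all (fun q => [&& q.1 < 3, 0 < q.2 & q.2 <= 6])%N l.

Definition det_terms a b c : seq term :=
  [:: (false, [:: (0, a); (1, b); (2, c)]); (true, [:: (0, a); (2, b); (1, c)]);
      (true, [:: (0, b); (1, a); (2, c)]); (false, [:: (0, b); (2, a); (1, c)]);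
      (false, [:: (0, c); (1, a); (2, b)]); (true, [:: (0, c); (2, a); (1, b)])]%N.

Definition cross_terms a b i : seq term :=
  [:: (false, [:: (i.+1 %% 3, a); (i.+2 %% 3, b)]);
      (true, [:: (i.+2 %% 3, a); (i.+1 %% 3, b)])]%N.

Definition mul_terms L L' : seq term :=
  [seq (t.1 (+) t'.1, t.2 ++ t'.2) | t <- L, t' <- L'].

Definition opp_terms L : seq term := [seq (~~ t.1, t.2) | t <- L].

Definition qs_terms i j k : seq term :=
  mul_terms (mul_terms (cross_terms 1 5 i) (cross_terms 2 6 j)) (cross_terms 3 4 k)
  ++ opp_terms
       (mul_terms (mul_terms (cross_terms 1 6 i) (cross_terms 2 4 j)) (cross_terms 3 5 k)).

Definition occ (b : bool) L u : nat := count (fun t => (t.1 == b) && perm_eq t.2 u) L.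

Definition weight T (q : nat * nat) : nat := (nth 0 (nth [::] T q.1) q.2.-1).+1.

Definition wt T l : nat := sumn [seq weight T q | q <- l].

Definition wtab T (k : 'I_(3 * 6)) : nat :=
  mxvec (\matrix_(i < 3, j < 6) (nth 0%N (nth [::] T i) j).+1) 0 k.

(** The word [u] has net coefficient 1 or -1, and every other word is lighter than [u] or
    cancels. *)
Definition lead_check T L u :=
  [&& in_range u, all (fun t => in_range t.2) L,
      (occ true L u == (occ false L u).+1) || (occ false L u == (occ true L u).+1) &
      all (fun t => [|| wt T t.2 < wt T u, perm_eq t.2 u |
                        occ true L t.2 == occ false L t.2])%N L].

Definition ix (q : nat * nat) : 'I_(3 * 6) := mxvec_index (inord q.1) (pt q.2).

Definition mon l : 'X_{1.. 3 * 6} := (\sum_(q <- l) U_(ix q))%MM.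

Lemma wtab_gt0 T k : (0 < wtab T k)%N.
Proof. by case/mxvec_indexP: k => i j; rewrite /wtab mxvecE mxE. Qed.

Lemma wtab_ix T q : in_range [:: q] -> wtab T (ix q) = weight T q.
Proof.
rewrite /= andbT => /and3P[q1 q2 q26]; rewrite /wtab mxvecE mxE.
by rewrite !inordK // -ltnS prednK.
Qed.

Lemma ix_inj q q' : in_range [:: q; q'] -> ix q = ix q' -> q = q'.
Proof.
case: q q' => [i k] [i' k'] /=; rewrite andbT => /andP[/and3P[i3 k0 k6] /and3P[i'3 k'0 k'6]].
rewrite /ix /pt => /cast_ord_inj/enum_rank_inj[/(congr1 (@nat_of_ord 3)) ii'].
move/(congr1 (@nat_of_ord 6)) => kk'; move: ii' kk'.
have lt_k : (k.-1 < 6)%N by rewrite prednK.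
have lt_k' : (k'.-1 < 6)%N by rewrite prednK.
rewrite (inordK i3) (inordK i'3) (inordK lt_k) (inordK lt_k') => -> kk'.
by rewrite -(prednK k0) kk' prednK.
Qed.

Lemma mon_ix l q : in_range (q :: l) -> mon l (ix q) = count_mem q l.
Proof.
elim: l => [|q' l IHl] /=; first by rewrite /mon big_nil mnm0E.
case/and3P=> rq rq' rl; rewrite /mon big_cons mnmDE -/(mon l) IHl /= ?rq // mnm1E.
by congr (nat_of_bool _ + _)%N; apply/eqP/eqP => [/ix_inj->|->] //=; rewrite rq rq'.
Qed.

Lemma eq_mon l u : in_range l -> in_range u -> (mon l == mon u) = perm_eq l u.
Proof.
move=> rl ru; apply/eqP/idP => [eq_lu|/(perm_big _)]; last exact.
apply/allP => q; rewrite mem_cat /= => q_lu.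
have rq : in_range [:: q].
  by rewrite /= andbT; case/orP: q_lu => [/(allP rl)|/(allP ru)].
rewrite /= -!mon_ix ?eq_lu //= ?rl ?ru andbT; by move: rq; rewrite /= andbT.
Qed.

Lemma wdeg_mon T l : in_range l -> wdeg (wtab T) (mon l) = wt T l.
Proof.
elim: l => [|q l IHl]; first by rewrite /mon big_nil wdeg0.
rewrite /= => /andP[rq rl]; rewrite /mon big_cons wdegD wdegU IHl // wtab_ix //.
by rewrite /= rq.
Qed.

Lemma mcoprime_mon l u : in_range l -> in_range u -> ~~ has (mem l) u ->
  mcoprime (mon l) (mon u).
Proof.
move=> rl ru /hasPn lu; apply/forallP=> k; apply/orP.
have mon0 l' : k \notin [seq ix q | q <- l'] -> mon l' k = 0%N.
  elim: l' => [|q l' IHl]; rewrite /mon ?big_nil ?mnm0E //= inE negb_or.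
  by rewrite eq_sym big_cons mnmDE mnm1E => /andP[/negPf-> /IHl].
have [/mapP[q q_l kq]|/mon0->] := boolP (k \in [seq ix q | q <- l]); last by left.
have [/mapP[q' q'_u kq']|/mon0->] := boolP (k \in [seq ix q | q <- u]); last by right.
have eq_qq' : q = q'.
  by apply: ix_inj; rewrite -?kq -?kq' //= (allP rl _ q_l) (allP ru _ q'_u).
by move: (lu _ q'_u); rewrite /= -eq_qq' q_l.
Qed.

(** A squarefree monomial divides [m] as soon as each of its variables does; this makes the colon
    computation Boolean. *)
Lemma mon_dvd l (m : 'X_{1.. 3 * 6}) : in_range l -> uniq l ->
  (mon l <= m)%MM = all (fun q => 0 < m (ix q))%N l.
Proof.
move=> rl ul; apply/mnm_lepP/allP => [le_m q q_l|pos_m k].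
  apply: leq_trans (le_m (ix q)); rewrite mon_ix ?count_uniq_mem ?q_l //.
  by rewrite /= rl (allP rl).
have [/mapP[q q_l ->]|k_n] := boolP (k \in [seq ix q | q <- l]).
  by rewrite mon_ix ?count_uniq_mem ?q_l ?pos_m //= rl (allP rl).
suff -> : mon l k = 0%N by [].
elim: l k_n {rl ul pos_m} => [|q l IHl]; rewrite /mon ?big_nil ?mnm0E //= inE negb_or.
by rewrite eq_sym big_cons mnmDE mnm1E => /andP[/negPf-> /IHl].
Qed.

Variable K : fieldType.
Local Notation P := {mpoly K[3 * 6]}.
Local Notation X := (var_mx K 3 6).

Definition den L : P := \sum_(t <- L) (-1) ^+ t.1 * \prod_(q <- t.2) ent X q.1 q.2.

Lemma monE l : \prod_(q <- l) ent X q.1 q.2 = 'X_[mon l].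
Proof. by rewrite -mprodXE; apply: eq_bigr => q _; rewrite /ent mxE. Qed.

Lemma den_mul L L' : den (mul_terms L L') = den L * den L'.
Proof.
rewrite /den big_flatten big_map big_distrl /=; apply: eq_bigr => t _.
rewrite big_map big_distrr /=; apply: eq_bigr => t' _.
by rewrite big_cat signr_addb mulrACA.
Qed.

Lemma den_opp L : den (opp_terms L) = - den L.
Proof.
rewrite /den big_map -sumrN; apply: eq_bigr => t _.
by rewrite signrN mulNr.
Qed.

Lemma den_det a b c : den (det_terms a b c) = det3 X a b c.
Proof. by rewrite /den !big_cons !big_nil /det3 /= ; ring. Qed.

Lemma den_cross a b i : den (cross_terms a b i) = cross X a b i.
Proof. by rewrite /den !big_cons !big_nil /cross /=; ring. Qed.

Lemma den_qs i j k : den (qs_terms i j k) = qs X i j k.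
Proof.
by rewrite /qs_terms {1}/den big_cat -!/(den _) den_opp !den_mul !den_cross.
Qed.

Lemma mcoeff_term (b : bool) (m k : 'X_{1.. 3 * 6}) :
  ((-1) ^+ b * 'X_[m] : P)@_k = (-1) ^+ b * (m == k)%:R.
Proof.
by case: b; rewrite ?expr1 ?expr0 ?mulN1r ?mul1r ?mcoeffN mcoeffX.
Qed.

Lemma mcoeff_den L u : in_range u -> all (fun t => in_range t.2) L ->
  (den L)@_(mon u) = (occ false L u)%:R - (occ true L u)%:R.
Proof.
move=> ru; elim: L => [|[b l] L IHL]; first by rewrite /den big_nil mcoeff0 subrr.
move=> /= /andP[rl rL]; rewrite /den big_cons mcoeffD -/(den L) IHL // monE mcoeff_term.
rewrite eq_mon //; case: perm_eq; last by rewrite !andbF mulr0 add0r.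
by case: b; rewrite /= mulr1 !natrD ?expr1 ?expr0; ring.
Qed.

Lemma lead_checkP T L u : lead_check T L u -> leads (wtab T) (den L) (mon u).
Proof.
case/and4P=> ru rL cu /allP LP; apply: leadsP; first exact: wtab_gt0.
  rewrite mcoeff_den //; case/orP: cu => /eqP->; rewrite -addn1 natrD.
    by rewrite opprD addNKr oppr_eq0 oner_eq0.
  by rewrite addrAC subrr add0r oner_eq0.
move=> m m_L; have /mapP[t t_L mE] : m \in [seq mon t.2 | t <- L].
  apply: contraT => m_n; move: m_L; rewrite mcoeff_msupp /den raddf_sum /= big1_seq ?eqxx //.
  move=> t /= t_L; rewrite monE mcoeff_term; case: eqP => [mE|]; last by rewrite mulr0.
  by case/negP: m_n; apply/mapP; exists t.
have rt := allP rL _ t_L; rewrite {}mE in m_L *.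
case/or3P: (LP _ t_L) => [lt_tu|tu|/eqP eq_occ].
- by right; rewrite !wdeg_mon.
- by left; apply/eqP; rewrite eq_mon.
- by move: m_L; rewrite mcoeff_msupp mcoeff_den // eq_occ subrr eqxx.
Qed.

End SignedWords.

(** * Evaluation and localization *)

(** Digits in base [D] are unique: reduce modulo [D], divide by [D], and recurse. *)
Lemma base_expansion_inj D n (f g : 'I_n -> nat) :
    (forall i, f i < D)%N -> (forall i, g i < D)%N ->
  (\sum_(i < n) D ^ i * f i = \sum_(i < n) D ^ i * g i)%N -> f =1 g.
Proof.
elim: n f g => [|n IHn] f g fD gD; first by move=> _ [].
have shift (h : 'I_n.+1 -> nat) : (\sum_(i < n.+1) D ^ i * h i =
    (\sum_(i < n) D ^ i * h (lift ord0 i)) * D + h ord0)%N.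
  rewrite big_ord_recl expn0 mul1n addnC big_distrl /=; congr (_ + _)%N.
  by apply: eq_bigr => i _; rewrite /bump add1n expnS -mulnA mulnC.
rewrite !shift => eq_fg; have D0 : (0 < D)%N by apply: leq_trans (fD ord0).
have f0 : f ord0 = g ord0.
  by have /(congr1 (modn^~ D)) := eq_fg; rewrite !modnMDl !modn_small.
move: eq_fg; rewrite f0 => /addIn/eqP; rewrite eqn_pmul2r // => /eqP eq_fg i.
case: (unliftP ord0 i) => [j|] -> //.
by apply: (IHn (fun k => f (lift ord0 k)) (fun k => g (lift ord0 k)) _ _ eq_fg).
Qed.

(** In characteristic zero the first [size q] natural numbers are distinct, which is more roots than
    a nonzero [q] can have. *)
Lemma poly_eval_eq0 (K : numFieldType) (q : {poly K}) : (forall t, q.[t] = 0) -> q = 0.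
Proof.
move=> q0; apply/eqP; apply: contraT => nz_q.
have := @max_poly_roots _ q [seq i%:R | i <- iota 0 (size q)] nz_q.
rewrite size_map size_iota ltnn => ->//.
  by apply/allP => t _; apply/eqP/q0.
by rewrite map_inj_uniq ?iota_uniq // => i j /eqP; rewrite eqr_nat => /eqP.
Qed.

Lemma mpoly_eval_eq0 (K : numFieldType) n (p : {mpoly K[n]}) :
  (forall v, p.@[v] = 0) -> p = 0.
Proof.
(* Kronecker substitution *)
move=> p0; pose D := msize p; pose code (m : 'X_{1..n}) := (\sum_(i < n) D ^ i * m i)%N.
pose q : {poly K} := \sum_(m <- msupp p) p@_m *: 'X^(code m).
have q_eq0 : q = 0.
  apply: poly_eval_eq0 => t; rewrite -[RHS](p0 (fun i : 'I_n => t ^+ (D ^ i))) mevalE.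
  rewrite horner_sum; apply: eq_bigr => m _; rewrite hornerZ hornerXn; congr (_ * _).
  by rewrite /code -prodrXr; apply: eq_bigr => i _; rewrite exprM.
have lt_D m i : m \in msupp p -> (m i < D)%N.
  move=> m_p; apply: leq_ltn_trans (msize_mdeg_lt m_p).
  by rewrite mdegE (bigD1 i) //= leq_addr.
apply/eqP; apply: contraT => p_neq0; have := mlead_supp p_neq0.
set m := mlead p => m_p.
have /(congr1 (coefp (code m))) := q_eq0; rewrite /coefp /= coef0 coef_sum.
rewrite (bigD1_seq m) ?msupp_uniq //= big1_seq => [|m' /andP[m'm m'_p]].
  by rewrite addr0 coefZ coefXn eqxx mulr1 => /eqP; rewrite mleadc_eq0 (negPf p_neq0).
rewrite coefZ coefXn; case: eqP => [eq_code|_]; last by rewrite mulr0.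
case/eqP: m'm; apply/mnmP => i; apply: base_expansion_inj i; last exact/esym/eq_code.
  by move=> i; apply: lt_D.
by move=> i; apply: lt_D.
Qed.

Lemma mpoly_ring_ind (K : fieldType) n (C : {mpoly K[n]} -> Prop) :
    (forall c, C c%:MP) -> (forall i, C 'X_i) ->
    (forall p q, C p -> C q -> C (p + q)) -> (forall p q, C p -> C q -> C (p * q)) ->
  forall p, C p.
Proof.
move=> CC CX CD CM; elim/mpolyind=> [|c m p _ _ Cp]; first by rewrite -mpolyC0.
apply: CD => //; rewrite -mul_mpolyC; apply: (CM) => //; rewrite mpolyXE_id.
apply: (big_ind C) => [|p1 p2|i _]; [by rewrite -mpolyC1 | exact: CM |].
elim: (m i) => [|k IHk]; first by rewrite expr0 -mpolyC1.
by rewrite exprS; apply: CM.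
Qed.

Lemma mulrBM (S : comNzRingType) (a b c d : S) :
  a * b - c * d = a * (b - d) + d * (a - c).
Proof. by ring. Qed.

Section Localization.

Variables (K : fieldType).
Local Notation P := {mpoly K[3 * 6]}.
Local Notation X := (var_mx K 3 6).
Local Notation "x %:F" := (FracField.tofrac x).
Implicit Types (d p q : P) (s : seq P) (z : {fraction P}).

(** Membership in the extension of the ideal of [s] to the ring P[1/d] inside the fraction field; [s
    = [:: 1]] gives that ring itself. *)
Definition in_loc d s z : Prop :=
  exists N q, ideal_span s q /\ d%:F ^+ N * z = q%:F.

Lemma ideal_span1 p : ideal_span [:: 1] p.
Proof. by rewrite -[p]mulr1; apply/ideal_spanM/mem_ideal_span; rewrite inE. Qed.

Lemma in_loc_frac d s q : ideal_span s q -> in_loc d s q%:F.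
Proof. by exists 0%N, q; rewrite mul1r. Qed.

Lemma in_locD d s z z' : in_loc d s z -> in_loc d s z' -> in_loc d s (z + z').
Proof.
move=> [N [q [sq zE]]] [N' [q' [sq' z'E]]].
exists (N + N')%N, (d ^+ N' * q + d ^+ N * q'); split.
  by apply: ideal_spanD; apply: ideal_spanM.
by rewrite mulrDr tofracD !tofracM !tofracXn -zE -z'E exprD; ring.
Qed.

Lemma in_locM d s z z' : in_loc d [:: 1] z -> in_loc d s z' -> in_loc d s (z * z').
Proof.
move=> [N [q [_ zE]]] [N' [q' [sq' z'E]]]; exists (N + N')%N, (q * q').
by split; [exact: ideal_spanM | rewrite tofracM -zE -z'E exprD; ring].
Qed.

Lemma in_locN d s z : in_loc d s z -> in_loc d s (- z).
Proof.
move=> [N [q [sq zE]]]; exists N, (- q).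
by split; [exact: ideal_spanN | rewrite mulrN zE tofracN].
Qed.

Lemma in_loc_div d s q : d != 0 -> ideal_span s q -> in_loc d s (q%:F / d%:F).
Proof.
move=> d0 sq; exists 1%N, q; split=> //.
by rewrite mulrCA mulfV ?mulr1 // tofrac_eq0.
Qed.

Lemma in_loc_span d s p : in_loc d s p%:F -> exists N, ideal_span s (d ^+ N * p).
Proof.
move=> [N [q [sq]]]; rewrite -tofracXn -tofracM => /eqP.
by rewrite tofrac_eq => /eqP dpq; exists N; rewrite dpq.
Qed.

Definition fsubst : 'M[{fraction P}]_(3, 6) -> P -> {fraction P} :=
  @subst K _ (@FracField.tofrac P \o @mpolyC (3 * 6) K).

Lemma fsubstC Y c : fsubst Y c%:MP = c%:MP%:F.
Proof. exact: substC. Qed.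

Lemma fsubstD Y p q : fsubst Y (p + q) = fsubst Y p + fsubst Y q.
Proof. exact: substD. Qed.

Lemma fsubstM Y p q : fsubst Y (p * q) = fsubst Y p * fsubst Y q.
Proof. exact: substM. Qed.

Lemma fsubstX Y i k : fsubst Y 'X_(mxvec_index i k) = Y i k.
Proof. exact: substX. Qed.

(** Polynomials take congruent values at congruent points. Membership of both values in P[1/d] is
    carried along because the product case needs it. *)
Lemma fsubst_congr d s (Y Z : 'M[{fraction P}]_(3, 6)) p :
    (forall i k, in_loc d [:: 1] (Y i k)) -> (forall i k, in_loc d [:: 1] (Z i k)) ->
    (forall i k, in_loc d s (Y i k - Z i k)) ->
  [/\ in_loc d [:: 1] (fsubst Y p), in_loc d [:: 1] (fsubst Z p) &
      in_loc d s (fsubst Y p - fsubst Z p)].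
Proof.
move=> Y1 Z1 YZ.
elim/mpoly_ring_ind: p => [c|k|q r [q1 q2 q3] [r1 r2 r3]|q r [q1 q2 q3] [r1 r2 r3]].
- rewrite !fsubstC subrr -tofrac0.
  by split; apply: in_loc_frac; [apply: ideal_span1 .. | apply: ideal_span0].
- by case/mxvec_indexP: k => i j; rewrite !fsubstX.
- rewrite !fsubstD opprD addrACA.
  by split; [exact: in_locD | exact: in_locD | exact: in_locD].
- rewrite !fsubstM mulrBM.
  split; [exact: in_locM | exact: in_locM |].
  by apply: in_locD; exact: in_locM.
Qed.

End Localization.

(** * Quadrilateral sets in the frame 4, 5, 1 *)

Definition triples : seq (seq nat) :=
  [:: [:: 1; 2; 3]; [:: 1; 2; 4]; [:: 1; 2; 5]; [:: 1; 2; 6]; [:: 1; 3; 4];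
      [:: 1; 3; 5]; [:: 1; 3; 6]; [:: 1; 4; 5]; [:: 1; 4; 6]; [:: 1; 5; 6];
      [:: 2; 3; 4]; [:: 2; 3; 5]; [:: 2; 3; 6]; [:: 2; 4; 5]; [:: 2; 4; 6];
      [:: 2; 5; 6]; [:: 3; 4; 5]; [:: 3; 4; 6]; [:: 3; 5; 6]; [:: 4; 5; 6]]%N.

Definition lines : seq (seq nat) :=
  [:: [:: 1; 2; 3]; [:: 1; 5; 6]; [:: 2; 4; 6]; [:: 3; 4; 5]]%N.

Definition det_at (S : comNzRingType) (Y : 'M[S]_(3, 6)) (t : seq nat) : S :=
  det3 Y (nth 0 t 0)%N (nth 0 t 1)%N (nth 0 t 2)%N.

Definition line_dets (K : fieldType) : seq {mpoly K[3 * 6]} :=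
  [seq det_at (var_mx K 3 6) l | l <- lines].

(** Realization of QS expressed by the 20 brackets alone: exactly those of the four lines vanish. *)
Definition quadrilateral (K : fieldType) (A : 'M[K]_(3, 6)) : bool :=
  [seq det_at A t == 0 | t <- triples] == [seq t \in lines | t <- triples].

Section BuildMatrix.

Variable S : comNzRingType.

Definition mx36 (f : nat -> nat -> S) : 'M[S]_(3, 6) :=
  \matrix_(i < 3, j < 6) f i j.+1.

Lemma ent_mx36 f i k : in_range [:: (i, k)] -> ent (mx36 f) i k = f i k.
Proof.
rewrite /= andbT => /and3P[i3 k0 k6]; rewrite /ent mxE.
have lt_k : (k.-1 < 6)%N by rewrite prednK.
by rewrite /pt (inordK i3) (inordK lt_k) prednK.
Qed.

End BuildMatrix.

Section Parametrization.

Variable S : comNzRingType.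
Implicit Type Y : 'M[S]_(3, 6).

(* The columns 4, 5, 1 of [frame_mx Y] are those of [Y]; its other columns are the
   combinations of these with coefficients the columns of [Y]. *)
Definition frame_mx Y : 'M[S]_(3, 6) := mx36 (fun i k =>
  if k \in [:: 4; 5; 1]%N then ent Y i k
  else ent Y i 4 * ent Y 0 k + ent Y i 5 * ent Y 1 k + ent Y i 1 * ent Y 2 k).

(* With respect to the frame 4, 5, 1 the columns 2, 6, 3 are (a, b, c),
   s (0, b, c) and t (a, b, 0). *)
Definition quad_mx Y : 'M[S]_(3, 6) :=
  let a := ent Y 0 2 in let b := ent Y 1 2 in let c := ent Y 2 2 in
  let s := ent Y 1 6 in let t := ent Y 1 3 in
  mx36 (fun i k => match k with
  | 2%N => ent Y i 4 * a + ent Y i 5 * b + ent Y i 1 * c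
  | 3%N => t * (ent Y i 4 * a + ent Y i 5 * b)
  | 6%N => s * (ent Y i 5 * b + ent Y i 1 * c)
  | _ => ent Y i k
  end).

Definition quad_unit Y : S :=
  det3 Y 4 5 1 * ent Y 0 2 * ent Y 1 2 * ent Y 2 2 * ent Y 1 6 * ent Y 1 3.

Lemma det_quad_mx Y :
  let D := det3 Y 4 5 1 in
  let a := ent Y 0 2 in let b := ent Y 1 2 in let c := ent Y 2 2 in
  let s := ent Y 1 6 in let t := ent Y 1 3 in
  [seq det_at (quad_mx Y) l | l <- triples] =
  [:: 0; - (D * b); D * a; D * (a * b * s); - (D * (b * t));
      D * (a * t); D * (a * b * s * t); D; D * (b * s); 0;
      - (D * (b * c * t)); D * (a * c * t); D * (a * b * c * s * t); D * c; 0;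
      D * (a * c * s); 0; - (D * (b * c * s * t)); D * (a * c * s * t); D * (c * s)].
Proof.
rewrite /= /det_at /det3 /= !ent_mx36 //=.
by do 20?[congr (_ :: _); first by ring].
Qed.

End Parametrization.

Lemma quadrilateral_quad_mx (K : fieldType) (Y : 'M[K]_(3, 6)) :
  quad_unit Y != 0 -> quadrilateral (quad_mx Y).
Proof.
rewrite /quad_unit /quadrilateral (map_comp (fun d => d == 0) (det_at _)) det_quad_mx.
rewrite !mulf_eq0 !negb_or; do 5!case/andP.
move=> /negPf D0 /negPf a0 /negPf b0 /negPf c0 /negPf s0 /negPf t0.
by rewrite !map_cons !(oppr_eq0, mulf_eq0, D0, a0, b0, c0, s0, t0) !eqxx.
Qed.

Section PathLemma.

Variable K : numFieldType.
Local Notation P := {mpoly K[3 * 6]}.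
Local Notation X := (var_mx K 3 6).
Local Notation "x %:F" := (FracField.tofrac x).

Definition vanishes_on_quadrilaterals (p : P) : Prop :=
  forall A : 'M[K]_(3, 6), quadrilateral A -> eval_mx A p = 0.

Lemma eval_mxE (A : 'M[K]_(3, 6)) p : eval_mx A p = subst idfun A p.
Proof. by []. Qed.

Lemma quad_mx_map (S S' : comNzRingType) (f : {rmorphism S -> S'}) (Y : 'M[S]_(3, 6)) :
  quad_mx (map_mx f Y) = map_mx f (quad_mx Y).
Proof.
apply/matrixP => i j; rewrite !mxE !ent_map.
by case: (j : nat) => [|[|[|[|[|[|k]]]]]] //; rewrite !(rmorphD, rmorphM).
Qed.

Lemma subst_quad_unit (A : 'M[K]_(3, 6)) :
  subst idfun A (quad_unit X) = quad_unit A.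
Proof. by rewrite /quad_unit !substM !subst_ent subst_det3. Qed.

Lemma quad_unit_neq0 : quad_unit X != 0.
Proof.
pose A : 'M[K]_(3, 6) := mx36 (fun i k => match k with
  | 4%N => (i == 0%N)%:R | 5%N => (i == 1%N)%:R | 1%N => (i == 2%N)%:R | _ => 1 end).
have : quad_unit A != 0.
  suff -> : quad_unit A = 1 by rewrite oner_eq0.
  by rewrite /quad_unit /det3 !ent_mx36 //=; ring.
by apply: contraNneq => u0; rewrite -subst_quad_unit u0 /subst mmap0.
Qed.

Lemma subst_comp (S : comNzRingType) (kappa : {rmorphism K -> S}) (Y : 'M[S]_(3, 6))
    (Z : 'M[P]_(3, 6)) p :
  subst kappa Y (subst (@mpolyC (3 * 6) K) Z p) = subst kappa (map_mx (subst kappa Y) Z) p.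
Proof.
elim/mpoly_ring_ind: p => [c|k|q r qE rE|q r qE rE].
- by rewrite !substC.
- case/mxvec_indexP: k => i j.
  by rewrite !substX mxE.
- by rewrite !substD qE rE.
- by rewrite !substM qE rE.
Qed.

(** Where [quad_unit] is nonzero, [quad_mx] gives a quadrilateral set and [p] vanishes there. So
    [quad_unit X * q] vanishes at every point and is 0, and the polynomial ring is a domain. *)
Lemma subst_quad_mx p : vanishes_on_quadrilaterals p ->
  subst (@mpolyC (3 * 6) K) (quad_mx X) p = 0.
Proof.
move=> p0; set q := subst _ _ p.
suff : quad_unit X * q = 0.
  by move/eqP; rewrite mulf_eq0 (negPf quad_unit_neq0) => /eqP.
apply: mpoly_eval_eq0 => v; pose A : 'M[K]_(3, 6) := \matrix_(i, j) v (mxvec_index i j).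
have -> : (quad_unit X * q).@[v] = subst idfun A (quad_unit X * q).
  by apply: meval_eq => k; case/mxvec_indexP: k => i j; rewrite mxvecE mxE.
rewrite substM subst_quad_unit /q subst_comp -quad_mx_map subst_var_mx.
have [->|uA] := eqVneq (quad_unit A) 0; first by rewrite mul0r.
by rewrite [subst _ _ p]p0 ?mulr0 //; apply: quadrilateral_quad_mx.
Qed.

End PathLemma.

Lemma frame_mx_map (S S' : comNzRingType) (f : {rmorphism S -> S'}) (Y : 'M[S]_(3, 6)) :
  frame_mx (map_mx f Y) = map_mx f (frame_mx Y).
Proof.
by apply/matrixP => i j; rewrite !mxE !ent_map; case: ifP => // _; rewrite !(rmorphD, rmorphM).
Qed.

Section FieldIdentities.

Variable F : fieldType.
Implicit Types a b c g h k z : F.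

(** Column 6 of the parametrization with [s = al / b], minus column 6 in the frame: what remains are
    multiples of the frame equations [z = 0] and [b * be = c * al]. The next identity does the same
    for column 3. *)
Lemma quad_frame_diff6 b c z al be g4 g5 g1 : b != 0 ->
  al / b * (g5 * b + g1 * c) - (g4 * z + g5 * al + g1 * be) =
  - (g4 * z + g1 * ((b * be - c * al) / b)).
Proof. by move=> b0; field. Qed.

Lemma quad_frame_diff3 a b z ep ze g4 g5 g1 : b != 0 ->
  ze / b * (g4 * a + g5 * b) - (g4 * ep + g5 * ze + g1 * z) =
  g4 * ((a * ze - b * ep) / b) - g1 * z.
Proof. by move=> b0; field. Qed.

End FieldIdentities.

Section Frame.

Variable K : numFieldType.
Local Notation P := {mpoly K[3 * 6]}.
Local Notation X := (var_mx K 3 6).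
Local Notation "x %:F" := (FracField.tofrac x).
Local Notation psubst := (subst (@mpolyC (3 * 6) K)).

(* The ideal of the four lines in a frame where the columns 4, 5, 1 are the
   standard basis. *)
Definition frame_gens : seq (P * 'X_{1.. 3 * 6}) :=
  [:: (den K [:: (false, [:: (2, 3)])], mon [:: (2, 3)]);
      (den K [:: (false, [:: (0, 6)])], mon [:: (0, 6)]);
      (den K [:: (false, [:: (1, 2); (2, 6)]); (true, [:: (2, 2); (1, 6)])],
       mon [:: (2, 2); (1, 6)]);
      (den K [:: (false, [:: (0, 2); (1, 3)]); (true, [:: (1, 2); (0, 3)])],
       mon [:: (0, 2); (1, 3)])]%N.

Lemma frame_gensE : unzip1 frame_gens =
  [:: ent X 2 3; ent X 0 6; ent X 1 2 * ent X 2 6 - ent X 2 2 * ent X 1 6;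
      ent X 0 2 * ent X 1 3 - ent X 1 2 * ent X 0 3].
Proof.
by rewrite /= /den !big_cons !big_nil /=; do 4?[congr (_ :: _); first by ring].
Qed.

(** Positions (2, 2) and (1, 3) get weight 2 and all others 1. The leads of the two binomials are
    then the products without b, the entry (1, 2). *)
Definition frame_weights : seq (seq nat) :=
  [:: [::]; [:: 0; 0; 1]; [:: 0; 1]]%N.

Lemma frame_gens_leads :
  all (fun t => leads (wtab frame_weights) t.1 t.2) frame_gens.
Proof. by rewrite /= !lead_checkP. Qed.

Lemma frame_gens_coprime : pairwise (@mcoprime _) (unzip2 frame_gens).
Proof. by rewrite /= !mcoprime_mon. Qed.

Lemma frame_regular N f :
  ideal_span (unzip1 frame_gens) (ent X 1 2 ^+ N * f) -> ideal_span (unzip1 frame_gens) f.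
Proof.
apply: (coprime_leads_regular (@wtab_gt0 frame_weights) (ms := mon [:: (1, 2)]%N)).
- exact: frame_gens_leads.
- exact: frame_gens_coprime.
- have -> : ent X 1 2 = den K [:: (false, [:: (1, 2)%N])].
    by rewrite /den !big_cons !big_nil /=; ring.
  exact: lead_checkP.
- by rewrite /= !mcoprime_mon.
Qed.

Lemma fsubst_frac (Z : 'M[P]_(3, 6)) p :
  fsubst (map_mx (@FracField.tofrac P) Z) p = (psubst Z p)%:F.
Proof.
elim/mpoly_ring_ind: p => [c|k|q r qE rE|q r qE rE].
- by rewrite fsubstC substC.
- by case/mxvec_indexP: k => i j; rewrite fsubstX substX mxE.
- by rewrite fsubstD substD qE rE tofracD.
- by rewrite fsubstM substM qE rE tofracM.
Qed.

Lemma psubst_id p : psubst X p = p.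
Proof.
elim/mpoly_ring_ind: p => [c|k|q r qE rE|q r qE rE].
- by rewrite substC.
- by case/mxvec_indexP: k => i j; rewrite substX mxE.
- by rewrite substD qE rE.
- by rewrite substM qE rE.
Qed.

Lemma fsubst_comp (Y : 'M[{fraction P}]_(3, 6)) (Z : 'M[P]_(3, 6)) p :
  fsubst Y (psubst Z p) = fsubst (map_mx (fsubst Y) Z) p.
Proof. exact: subst_comp. Qed.

Lemma fsubst_var_mx (Y : 'M[{fraction P}]_(3, 6)) : map_mx (fsubst Y) X = Y.
Proof. exact: subst_var_mx. Qed.

Local Notation b := (ent X 1 2).

(** The generic columns with s = alpha / b and t = zeta / b, the values forced by the frame
    equations once b is inverted. *)
Definition frac_params : 'M[{fraction P}]_(3, 6) := mx36 (fun i k =>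
  if (i == 1)%N && (k == 3)%N then (ent X 1 3)%:F / b%:F
  else if (i == 1)%N && (k == 6)%N then (ent X 1 6)%:F / b%:F
  else (ent X i k)%:F).

Lemma ent_X_neq0 i k : in_range [:: (i, k)] -> ent X i k != 0.
Proof.
move=> rik; have : @leads K _ (wtab [::]) (den K [:: (false, [:: (i, k)])]) (mon [:: (i, k)]).
  apply: lead_checkP; rewrite /lead_check /= in rik *.
  by rewrite !andbT in rik *; rewrite rik /occ /= perm_refl orbT.
by move/leads_neq0; rewrite /den big_seq1 mul1r big_seq1.
Qed.

(** After inverting b, the parametrized matrix [Y] and the frame matrix [Z] agree modulo the frame
    ideal. As [p] vanishes at [Y], its value at [Z] lies in the localized ideal, and b can be
    cancelled because it is a nonzerodivisor. *)
Lemma frame_in_ideal p : vanishes_on_quadrilaterals p ->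
  ideal_span (unzip1 frame_gens) (psubst (frame_mx X) p).
Proof.
move=> p0; set s := unzip1 _.
have b0 : b != 0 by apply: ent_X_neq0.
have gP g : g \in s -> ideal_span s g by apply: mem_ideal_span.
move: gP; rewrite {1}/s frame_gensE => gP.
set Y := quad_mx frac_params; set Z := map_mx (@FracField.tofrac P) (frame_mx X).
have one_loc : forall q : P, in_loc b [:: 1] q%:F.
  by move=> q; apply/in_loc_frac/ideal_span1.
have div_loc : forall q : P, in_loc b [:: 1] (q%:F / b%:F).
  by move=> q; apply: in_loc_div => //; apply: ideal_span1.
have paramE (i : 'I_3) (k : nat) : k \in [:: 1; 2; 4; 5]%N ->
    ent frac_params i k = (ent X i k)%:F.
  rewrite !inE => k_in; rewrite ent_mx36 /=; last by case/or4P: k_in => /eqP->; rewrite ltn_ord.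
  by case/or4P: k_in => /eqP->; rewrite andbF.
have param2E (i k : nat) : (i < 3)%N -> k \in [:: 1; 2; 4; 5]%N ->
    ent frac_params i k = (ent X i k)%:F.
  by move=> i3 k_in; rewrite -(inordK i3) paramE.
have param3E : ent frac_params 1 3 = (ent X 1 3)%:F / b%:F by rewrite ent_mx36.
have param6E : ent frac_params 1 6 = (ent X 1 6)%:F / b%:F by rewrite ent_mx36.
have bF0 : b%:F != 0 by rewrite tofrac_eq0.
have loc0 s' : in_loc b s' 0 by rewrite -tofrac0; apply/in_loc_frac/ideal_span0.
have Z_loc i k : in_loc b [:: 1] (Z i k) by rewrite mxE.
have Y_loc i k : in_loc b [:: 1] (Y i k).
  rewrite /Y mxE; case: k => -[|[|[|[|[|[|//]]]]]] _ /=;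
    rewrite ?param3E ?param6E ?paramE ?param2E // -?tofracM -?tofracD //;
    by apply: in_locM.
(* Columns 1, 2, 4, 5 agree exactly; columns 3 and 6 differ by combinations of the frame equations,
   some divided by [b]. *)
have YZ i k : in_loc b s (Y i k - Z i k).
  rewrite !mxE.
  case: k => -[|[|[|[|[|[|//]]]]]] lt_k6 /=; rewrite ?param3E ?param6E ?paramE ?param2E //.
  - by rewrite subrr; exact: loc0.
  - by rewrite !tofracD !tofracM subrr; exact: loc0.
  - rewrite !tofracD !tofracM (quad_frame_diff3 _ _ _ _ _ _ _ bF0).
    apply: in_locD; last apply: in_locN; apply: in_locM => //.
      rewrite -!tofracM -tofracB; apply: in_loc_div => //.
      by apply: gP; rewrite !inE eqxx !orbT.
    by apply/in_loc_frac/gP; rewrite !inE eqxx.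
  - by rewrite subrr; exact: loc0.
  - by rewrite subrr; exact: loc0.
  rewrite !tofracD !tofracM (quad_frame_diff6 _ _ _ _ _ _ _ bF0).
  apply: in_locN; apply: in_locD; apply: in_locM => //.
    by apply/in_loc_frac/gP; rewrite !inE eqxx orbT.
  rewrite -!tofracM -tofracB; apply: in_loc_div => //.
  by apply: gP; rewrite !inE eqxx !orbT.
have [_ _] := fsubst_congr p Y_loc Z_loc YZ.
have -> : fsubst Y p = 0.
  rewrite /Y -[frac_params]fsubst_var_mx quad_mx_map -fsubst_comp subst_quad_mx //.
  by rewrite /fsubst /subst mmap0.
rewrite sub0r fsubst_frac => /in_locN; rewrite opprK.
by case/in_loc_span => N; apply: frame_regular.
Qed.

End Frame.

(** * From the frame back to arbitrary columns *)

Lemma comb3_divr (F : fieldType) (d g4 g5 g1 x y z : F) :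
  g4 * (x / d) + g5 * (y / d) + g1 * (z / d) = (g4 * x + g5 * y + g1 * z) / d.
Proof. by rewrite !mulrA -!mulrDl. Qed.

Section BracketIdentities.

Variables (S : comNzRingType) (Y : 'M[S]_(3, 6)).

Lemma cramer (i : 'I_3) k : ent Y i 4 * det3 Y k 5 1 + ent Y i 5 * det3 Y 4 k 1
  + ent Y i 1 * det3 Y 4 5 k = det3 Y 4 5 1 * ent Y i k.
Proof.
have -> : i = inord (i : nat) by apply/val_inj; rewrite /= inordK.
case: i => -[|[|[|//]]] lt_i3; rewrite /det3 /ent /= !(inord_val, inordK) //; ring.
Qed.

(** Three-term Pluecker relations. Here and in the next lemma they turn a binomial frame equation,
    written in Cramer coordinates, into a line bracket times the bracket of 4, 5, 1. *)
Lemma minor246 : det3 Y 4 2 1 * det3 Y 4 5 6 - det3 Y 4 5 2 * det3 Y 4 6 1 =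
  - (det3 Y 4 5 1 * det3 Y 2 4 6).
Proof. by rewrite /det3; ring. Qed.

Lemma minor123 : det3 Y 2 5 1 * det3 Y 4 3 1 - det3 Y 4 2 1 * det3 Y 3 5 1 =
  det3 Y 4 5 1 * det3 Y 1 2 3.
Proof. by rewrite /det3; ring. Qed.

End BracketIdentities.

Section PathIdeal.

Variable K : numFieldType.
Local Notation P := {mpoly K[3 * 6]}.
Local Notation X := (var_mx K 3 6).
Local Notation "x %:F" := (FracField.tofrac x).
Local Notation psubst := (subst (@mpolyC (3 * 6) K)).
Local Notation D := (det3 X 4 5 1).

(** The coordinates of the columns 2, 3, 6 in the frame 4, 5, 1 by Cramer's rule. The frame columns
    themselves are kept, so that [frame_mx] recovers the original matrix. *)
Definition frame_coords : 'M[{fraction P}]_(3, 6) := mx36 (fun i k =>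
  if k \in [:: 4; 5; 1]%N then (ent X i k)%:F
  else (nth 0 [:: det3 X k 5 1; det3 X 4 k 1; det3 X 4 5 k] i)%:F / D%:F).

Lemma det451_neq0 : D != 0.
Proof. by apply: contraNneq (quad_unit_neq0 K) => D0; rewrite /quad_unit D0 !mul0r. Qed.

Lemma frame_mx_coords : frame_mx frame_coords = map_mx (@FracField.tofrac P) X.
Proof.
have D0 : D%:F != 0 by rewrite tofrac_eq0 det451_neq0.
apply/matrixP => i k; rewrite [LHS]mxE.
have col_entE (j : nat) : j \in [:: 4; 5; 1]%N -> ent frame_coords i j = (ent X i j)%:F.
  rewrite !inE => j_in; rewrite ent_mx36 /=; last by case/or3P: j_in => /eqP->; rewrite ltn_ord.
  by rewrite !inE j_in.
have XE : X i k = ent X i k.+1 by rewrite ent_ord.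
case: ifP => [k_in|k_n]; first by rewrite col_entE // mxE XE.
have ckE (j : nat) : (j < 3)%N -> ent frame_coords j k.+1 =
    (nth 0 [:: det3 X k.+1 5 1; det3 X 4 k.+1 1; det3 X 4 5 k.+1] j)%:F / D%:F.
  by move=> j3; rewrite ent_mx36 /= ?k_n // j3 ltn_ord.
rewrite !col_entE // !ckE // comb3_divr -!tofracM -!tofracD cramer tofracM.
by rewrite [D%:F * _]mulrC mulfK // mxE XE.
Qed.

(** [p] is its expression in the frame evaluated at [frame_coords]. That expression lies in the
    frame ideal, and at [frame_coords] each frame generator becomes, up to sign, a line bracket over
    D. *)
Lemma path_ideal p : vanishes_on_quadrilaterals p ->
  exists N, ideal_span (line_dets K) (D ^+ N * p).
Proof.
move=> p0; apply: (@in_loc_span K D (line_dets K) p); have D0 := det451_neq0.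
have line_in l : l \in lines -> ideal_span (line_dets K) (det_at X l).
  by move=> l_in; apply/mem_ideal_span/map_f.
have W_loc i k : in_loc D [:: 1] (frame_coords i k).
  rewrite mxE; case: ifP => _; first exact/in_loc_frac/ideal_span1.
  by apply: in_loc_div => //; apply: ideal_span1.
have -> : p%:F = fsubst frame_coords (psubst (frame_mx X) p).
  rewrite fsubst_comp -frame_mx_map fsubst_var_mx frame_mx_coords.
  by rewrite fsubst_frac psubst_id.
have := frame_in_ideal p0; move: (psubst _ p).
apply: (ideal_span_ind (I := fun q => in_loc D (line_dets K) (fsubst frame_coords q))).
- rewrite /fsubst /subst mmap0 -tofrac0; exact/in_loc_frac/ideal_span0.
- by move=> q r qP rP; rewrite fsubstD; apply: in_locD.
- move=> q r rP; rewrite fsubstM; apply: in_locM => //.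
  have WW i k : in_loc D [:: 1] (frame_coords i k - frame_coords i k).
    by rewrite subrr -tofrac0; exact/in_loc_frac/ideal_span0.
  by have [] := fsubst_congr q W_loc W_loc WW.
have coordE i k : (i < 3)%N -> k \in [:: 2; 3; 6]%N -> fsubst frame_coords (ent X i k) =
    (nth 0 [:: det3 X k 5 1; det3 X 4 k 1; det3 X 4 5 k] i)%:F / D%:F.
  move=> i3 k_in; rewrite [LHS]subst_ent ent_mx36 /=.
    by move: k_in; rewrite !inE; case/or3P=> /eqP->.
  by move: k_in; rewrite i3 !inE; case/or3P=> /eqP->.
(* The two products have denominator D squared; the Pluecker relation supplies a factor D that
   cancels one of them. *)
have minorE (x y z w : P) u : x * y - z * w = D * u ->
    x%:F / D%:F * (y%:F / D%:F) - z%:F / D%:F * (w%:F / D%:F) = u%:F / D%:F.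
  move=> xyzw; rewrite !mulf_div -!mulrBl -!tofracM -tofracB xyzw !tofracM.
  by rewrite -mulf_div divff ?mul1r // tofrac_eq0.
have fsubstB q r : fsubst frame_coords (q - r) =
    fsubst frame_coords q - fsubst frame_coords r.
  by rewrite -mulN1r -mpolyC1 -mpolyCN fsubstD fsubstM fsubstC mpolyCN mpolyC1 tofracN mulN1r.
move=> g; rewrite frame_gensE !inE; case/or4P=> /eqP->.
- rewrite coordE //=; apply: in_loc_div => //.
  have -> : det3 X 4 5 3 = det3 X 3 4 5 by rewrite /det3; ring.
  exact: (line_in [:: 3; 4; 5]%N).
- rewrite coordE //=; apply: in_loc_div => //.
  have -> : det3 X 6 5 1 = - det3 X 1 5 6 by rewrite /det3; ring.
  by apply/ideal_spanN/(line_in [:: 1; 5; 6]%N).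
- rewrite fsubstB !fsubstM !coordE //= (minorE _ _ _ _ (- det3 X 2 4 6)).
    by apply: in_loc_div => //; apply/ideal_spanN/(line_in [:: 2; 4; 6]%N).
  by rewrite minor246 mulrN.
rewrite fsubstB !fsubstM !coordE //= (minorE _ _ _ _ (det3 X 1 2 3)).
  by apply: in_loc_div => //; apply/(line_in [:: 1; 2; 3]%N).
by rewrite minor123.
Qed.

End PathIdeal.

(** * Automorphisms *)

Section Relabel.

(** The list [s] holds the images of the labels 1, ..., 6. *)
Definition relabel (s : seq nat) (k : nat) : nat := nth 0%N s k.-1.

Definition relabel_mx (S : comNzRingType) s (Y : 'M[S]_(3, 6)) : 'M[S]_(3, 6) :=
  mx36 (fun i k => ent Y i (relabel s k)).

Definition is_automorphism (s : seq nat) : bool :=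
  all (fun t => let t' := sort leq (map (relabel s) t) in
    (t' \in triples) && ((t' \in lines) == (t \in lines))) triples.

Variable S : comNzRingType.
Implicit Type Y : 'M[S]_(3, 6).

Lemma relabel_mx_map (S' : comNzRingType) (f : {rmorphism S -> S'}) s Y :
  relabel_mx s (map_mx f Y) = map_mx f (relabel_mx s Y).
Proof. by apply/matrixP => i j; rewrite !mxE ent_map. Qed.

Definition labels3 t := (size t == 3%N) && all (fun k => 0 < k <= 6)%N t.

Lemma triples_labels3 t : t \in triples -> labels3 t.
Proof. by move: t; apply/allP. Qed.

Lemma det_relabel_mx s Y t : labels3 t ->
  det_at (relabel_mx s Y) t = det_at Y (map (relabel s) t).
Proof.
case: t => [|a [|b [|c [|//]]]] //= /and5P[_ ra rb rc _].
by rewrite /det_at /det3 !ent_mx36 //= ?ra ?rb ?rc.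
Qed.

Lemma det_sort Y t : size t = 3 ->
  det_at Y (sort leq t) = det_at Y t \/ det_at Y (sort leq t) = - det_at Y t.
Proof.
case: t => [|a [|b [|c [|//]]]] // _; rewrite /sort /=.
by do ?[case: ifP => _ /=]; rewrite /det_at /det3 /=; (left; ring) || (right; ring).
Qed.

End Relabel.

Lemma quadrilateralP (K : fieldType) (A : 'M[K]_(3, 6)) :
  reflect {in triples, forall t, (det_at A t == 0) = (t \in lines)} (quadrilateral A).
Proof. by apply: (iffP eqP) => /eq_in_map. Qed.

Lemma quadrilateral_relabel (K : fieldType) s (A : 'M[K]_(3, 6)) :
  is_automorphism s -> quadrilateral A -> quadrilateral (relabel_mx s A).
Proof.
move=> /allP s_aut /quadrilateralP quadA; apply/quadrilateralP => t t3.
have /andP[st3 /eqP<-] := s_aut _ t3; have lt := triples_labels3 t3.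
rewrite -(quadA _ st3) det_relabel_mx //.
have size_t : size (map (relabel s) t) = 3.
  by rewrite size_map; apply/eqP; case/andP: lt.
by case: (det_sort A size_t) => ->; rewrite ?oppr_eq0.
Qed.

Section Transport.

Variable K : numFieldType.
Local Notation P := {mpoly K[3 * 6]}.
Local Notation X := (var_mx K 3 6).
Local Notation psubst := (subst (@mpolyC (3 * 6) K)).

Definition inverse_labels (s s' : seq nat) : bool :=
  all (fun k => (0 < relabel s' k <= 6) && (relabel s (relabel s' k) == k))%N (iota 1 6).

Lemma line_in_span t : size t = 3%N -> sort leq t \in lines ->
  ideal_span (line_dets K) (det_at X t).
Proof.
move=> t3 st_line; have : ideal_span (line_dets K) (det_at X (sort leq t)).
  exact/mem_ideal_span/map_f.
by case: (det_sort X t3) => -> // /ideal_spanN; rewrite opprK.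
Qed.

(** Permute the columns by [s'], apply the result for the frame 4, 5, 1, and permute back by [s]. An
    automorphism permutes the line brackets up to sign. *)
Lemma path_ideal_relabel s s' p :
    is_automorphism s -> is_automorphism s' -> inverse_labels s s' ->
    vanishes_on_quadrilaterals p ->
  exists N, ideal_span (line_dets K) (det_at X (map (relabel s) [:: 4; 5; 1]%N) ^+ N * p).
Proof.
move=> s_aut s'_aut /allP ss' p0; pose q := psubst (relabel_mx s' X) p.
have q0 : vanishes_on_quadrilaterals q.
  move=> A quadA; rewrite eval_mxE /q subst_comp -relabel_mx_map subst_var_mx.
  exact/p0/quadrilateral_relabel.
have [N qN] := path_ideal q0; exists N.
have pE : psubst (relabel_mx s X) q = p.
  rewrite /q subst_comp -relabel_mx_map subst_var_mx -[RHS]psubst_id; congr (psubst _ p).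
  apply/matrixP => i j; rewrite [LHS]mxE -[RHS]ent_ord.
  have /ss'/andP[lt_s'j /eqP s'jK] : j.+1 \in iota 1 6 by rewrite mem_iota /= add1n ltnS ltn_ord.
  by rewrite ent_mx36 ?s'jK //= ltn_ord lt_s'j.
have <- : psubst (relabel_mx s X) (det3 X 4 5 1 ^+ N * q) =
    det_at X (map (relabel s) [:: 4; 5; 1]%N) ^+ N * p.
  by rewrite substM pE substXn subst_det3 -det_relabel_mx.
move: qN; move: (_ * q).
apply: (ideal_span_ind (I := fun r => ideal_span (line_dets K) (psubst (relabel_mx s X) r))).
- by rewrite /subst mmap0; apply: ideal_span0.
- by move=> r r' rI r'I; rewrite substD; apply: ideal_spanD.
- by move=> r r' r'I; rewrite substM; apply: ideal_spanM.
move=> _ /mapP[l l_line ->]; rewrite [psubst _ _]subst_det3 -/(det_at _ l).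
have l3 : l \in triples by move: l l_line; apply/allP.
have ll := triples_labels3 l3; rewrite det_relabel_mx //; apply: line_in_span.
  by rewrite size_map; apply/eqP; case/andP: ll.
by have /andP[_ /eqP->] := allP s_aut _ l3.
Qed.

End Transport.

(** * Menelaus' theorem and symmetry of the QS polynomials *)

Section Menelaus.

Variables (S : comNzRingType) (Y : 'M[S]_(3, 6)) (al be ga de ep ze : S).
Hypothesis Y1 : forall i, (i < 3)%N -> ent Y i 1 = al * ent Y i 5 + be * ent Y i 6.
Hypothesis Y2 : forall i, (i < 3)%N -> ent Y i 2 = ga * ent Y i 6 + de * ent Y i 4.
Hypothesis Y3 : forall i, (i < 3)%N -> ent Y i 3 = ep * ent Y i 4 + ze * ent Y i 5.

(** The points 1, 2, 3 lie on the sides 56, 64, 45 of the triangle 4, 5, 6; the first factor is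
    Menelaus' condition for their collinearity. *)
Lemma menelaus_det : det3 Y 1 2 3 = (al * ga * ep + be * de * ze) * det3 Y 4 5 6.
Proof. by rewrite /det3 !Y1 // !Y2 // !Y3 //; ring. Qed.

(** The Menelaus factor splits off from every QS polynomial, so these all vanish when 1, 2, 3 are
    collinear and 4, 5, 6 are not. *)
Lemma menelaus_qs i j k : qs Y i j k =
  (al * ga * ep + be * de * ze) * (cross Y 6 5 i * cross Y 4 6 j * cross Y 5 4 k).
Proof.
have mod3 n : (n %% 3 < 3)%N by rewrite ltn_mod.
have c15 : cross Y 1 5 i = be * cross Y 6 5 i by rewrite /cross !Y1 //; ring.
have c16 : cross Y 1 6 i = - al * cross Y 6 5 i by rewrite /cross !Y1 //; ring.
have c26 : cross Y 2 6 j = de * cross Y 4 6 j by rewrite /cross !Y2 //; ring.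
have c24 : cross Y 2 4 j = - ga * cross Y 4 6 j by rewrite /cross !Y2 //; ring.
have c34 : cross Y 3 4 k = ze * cross Y 5 4 k by rewrite /cross !Y3 //; ring.
have c35 : cross Y 3 5 k = - ep * cross Y 5 4 k by rewrite /cross !Y3 //; ring.
by rewrite /qs c15 c16 c26 c24 c34 c35; ring.
Qed.

End Menelaus.

Section CramerField.

Variables (F : fieldType) (A : 'M[F]_(3, 6)) (a b c d : nat).

Lemma cramer4 i : (i < 3)%N -> det3 A a b c * ent A i d =
  det3 A d b c * ent A i a + det3 A a d c * ent A i b + det3 A a b d * ent A i c.
Proof. by case: i => [|[|[|//]]] _; rewrite /det3; ring. Qed.

Lemma combination_of_det0 i : (i < 3)%N -> det3 A a b c != 0 -> det3 A d b c = 0 ->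
  ent A i d = det3 A a d c / det3 A a b c * ent A i b
            + det3 A a b d / det3 A a b c * ent A i c.
Proof.
move=> i3 D0 d0; apply: (mulfI D0); rewrite cramer4 // d0 mul0r add0r.
by field.
Qed.

End CramerField.

Lemma det3_cycle (S : comNzRingType) (Y : 'M[S]_(3, 6)) a b c : det3 Y a b c = det3 Y b c a.
Proof. by rewrite /det3; ring. Qed.

Lemma quadrilateral_lines (K : fieldType) (A : 'M[K]_(3, 6)) : quadrilateral A ->
  [/\ det3 A 4 5 6 != 0, det3 A 1 2 3 = 0, det3 A 1 5 6 = 0, det3 A 2 4 6 = 0
    & det3 A 3 4 5 = 0].
Proof.
move=> /quadrilateralP quadA; split.
- by rewrite [_ == _](quadA [:: 4; 5; 6]%N).
- by apply/eqP; rewrite [_ == _](quadA [:: 1; 2; 3]%N).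
- by apply/eqP; rewrite [_ == _](quadA [:: 1; 5; 6]%N).
- by apply/eqP; rewrite [_ == _](quadA [:: 2; 4; 6]%N).
- by apply/eqP; rewrite [_ == _](quadA [:: 3; 4; 5]%N).
Qed.

Lemma quadrilateral_qs (K : fieldType) (A : 'M[K]_(3, 6)) i j k :
  quadrilateral A -> qs A i j k = 0.
Proof.
case/quadrilateral_lines=> D0 d123 d156 d246 d345.
have D0' : det3 A 5 6 4 != 0 by rewrite -det3_cycle.
have D0'' : det3 A 6 4 5 != 0 by rewrite -det3_cycle.
have d264 : det3 A 2 6 4 = 0.
  by rewrite -[RHS]oppr0 -d246 /det3; ring.
have Y1 i' i3 := @combination_of_det0 K A 4 5 6 1 i' i3 D0 d156.
have Y2 i' i3 := @combination_of_det0 K A 5 6 4 2 i' i3 D0' d264.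
have Y3 i' i3 := @combination_of_det0 K A 6 4 5 3 i' i3 D0'' d345.
rewrite (menelaus_qs Y1 Y2 Y3).
have /eqP := menelaus_det Y1 Y2 Y3.
by rewrite d123 eq_sym mulf_eq0 (negPf D0) orbF => /eqP->; rewrite mul0r.
Qed.

Section Swaps.

Variables (S : comNzRingType) (Y : 'M[S]_(3, 6)).

(** This and the next two identities sort the indices of the three unsorted elements of the Groebner
    basis, modulo the line brackets. *)
Lemma qs_swap101 : qs Y 1 0 1 = qs Y 0 1 1
  - cross Y 3 4 1 * ent Y 2 2 * det3 Y 1 5 6 - cross Y 3 5 1 * ent Y 2 1 * det3 Y 2 4 6
  + cross Y 4 5 1 * ent Y 2 6 * det3 Y 1 2 3 - cross Y 1 2 1 * ent Y 2 6 * det3 Y 3 4 5.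
Proof. by rewrite /qs /cross /det3 /=; ring. Qed.

Lemma qs_swap021 : qs Y 0 2 1 = qs Y 0 1 2
  + cross Y 1 5 0 * ent Y 0 3 * det3 Y 2 4 6 + cross Y 1 6 0 * ent Y 0 2 * det3 Y 3 4 5
  + cross Y 5 6 0 * ent Y 0 4 * det3 Y 1 2 3 - cross Y 2 3 0 * ent Y 0 4 * det3 Y 1 5 6.
Proof. by rewrite /qs /cross /det3 /=; ring. Qed.

Lemma qs_swap121 : qs Y 1 2 1 = qs Y 1 1 2
  + cross Y 1 5 1 * ent Y 0 3 * det3 Y 2 4 6 + cross Y 1 6 1 * ent Y 0 2 * det3 Y 3 4 5
  + cross Y 5 6 1 * ent Y 0 4 * det3 Y 1 2 3 - cross Y 2 3 1 * ent Y 0 4 * det3 Y 1 5 6.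
Proof. by rewrite /qs /cross /det3 /=; ring. Qed.

End Swaps.

(** * The Groebner basis *)

(* Found by a computer search; [weight] adds 1 to the entries to make them positive. *)
Definition qs_weights : seq (seq nat) :=
  [:: [:: 2; 2; 0; 1; 0; 2]; [:: 2; 0; 3; 0; 3; 1]; [:: 0; 3; 3; 3; 2; 0]]%N.

Definition line_leads : seq (seq nat * seq (nat * nat)) :=
  [:: ([:: 1; 2; 3], [:: (0, 1); (1, 3); (2, 2)]);
      ([:: 1; 5; 6], [:: (0, 6); (1, 1); (2, 5)]);
      ([:: 2; 4; 6], [:: (0, 2); (1, 6); (2, 4)]);
      ([:: 3; 4; 5], [:: (0, 4); (1, 5); (2, 3)])]%N.

Definition qs_leads : seq (seq nat * seq (nat * nat)) :=
  [:: ([:: 0; 0; 0], [:: (1, 1); (1, 3); (1, 6); (2, 2); (2, 4); (2, 5)]);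
      ([:: 0; 0; 1], [:: (0, 4); (1, 1); (1, 6); (2, 2); (2, 3); (2, 5)]);
      ([:: 0; 0; 2], [:: (0, 4); (1, 1); (1, 3); (1, 6); (2, 2); (2, 5)]);
      ([:: 0; 2; 1], [:: (0, 2); (0, 4); (1, 1); (1, 6); (2, 3); (2, 5)]);
      ([:: 0; 2; 2], [:: (0, 2); (0, 4); (1, 1); (1, 3); (1, 6); (2, 5)]);
      ([:: 1; 0; 1], [:: (0, 1); (0, 4); (1, 6); (2, 2); (2, 3); (2, 5)]);
      ([:: 1; 1; 1], [:: (0, 1); (0, 4); (0, 6); (2, 2); (2, 3); (2, 5)]);
      ([:: 1; 2; 1], [:: (0, 1); (0, 2); (0, 4); (1, 6); (2, 3); (2, 5)]);
      ([:: 1; 2; 2], [:: (0, 1); (0, 2); (0, 4); (1, 3); (1, 6); (2, 5)]);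
      ([:: 2; 2; 2], [:: (0, 1); (0, 2); (0, 4); (1, 3); (1, 5); (1, 6)])]%N.

(* Automorphisms with their inverses, and the leading monomials of the brackets of
   the images of 4, 5, 1. *)
Definition path_leads : seq ((seq nat * seq nat) * seq (nat * nat)) :=
  [:: ([:: 1; 2; 3; 4; 5; 6], [:: 1; 2; 3; 4; 5; 6], [:: (0, 1); (1, 5); (2, 4)]);
      ([:: 1; 3; 2; 4; 6; 5], [:: 1; 3; 2; 4; 6; 5], [:: (0, 6); (1, 1); (2, 4)]);
      ([:: 1; 5; 6; 4; 2; 3], [:: 1; 5; 6; 4; 2; 3], [:: (0, 2); (1, 1); (2, 4)]);
      ([:: 1; 6; 5; 4; 3; 2], [:: 1; 6; 5; 4; 3; 2], [:: (0, 1); (1, 3); (2, 4)]);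
      ([:: 2; 1; 3; 5; 4; 6], [:: 2; 1; 3; 5; 4; 6], [:: (0, 2); (1, 5); (2, 4)]);
      ([:: 2; 3; 1; 5; 6; 4], [:: 3; 1; 2; 6; 4; 5], [:: (0, 6); (1, 5); (2, 2)]);
      ([:: 2; 4; 6; 5; 1; 3], [:: 5; 1; 6; 2; 4; 3], [:: (0, 1); (1, 5); (2, 2)]);
      ([:: 2; 6; 4; 5; 3; 1], [:: 6; 1; 5; 3; 4; 2], [:: (0, 2); (1, 5); (2, 3)]);
      ([:: 3; 1; 2; 6; 4; 5], [:: 2; 3; 1; 5; 6; 4], [:: (0, 6); (1, 3); (2, 4)]);
      ([:: 3; 2; 1; 6; 5; 4], [:: 3; 2; 1; 6; 5; 4], [:: (0, 6); (1, 5); (2, 3)]);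
      ([:: 3; 4; 5; 6; 1; 2], [:: 5; 6; 1; 2; 3; 4], [:: (0, 6); (1, 1); (2, 3)]);
      ([:: 3; 5; 4; 6; 2; 1], [:: 6; 5; 1; 3; 2; 4], [:: (0, 6); (1, 3); (2, 2)])]%N.

(* The colon of the ideal of the line leads by the path leads is generated by the
   line leads and the QS leads. *)
Lemma colon_check (B : nat * nat -> bool) :
    all (fun t => has (fun l => all (fun q => (q \in t.2) || B q) l.2) line_leads)
        path_leads ->
  has (fun l => all B l.2) (line_leads ++ qs_leads).
Proof.
rewrite /=.
(* Only twelve of the eighteen positions occur in the tables, which leaves 2^12 Boolean cases. *)
move: (B (0, 1)%N) (B (0, 2)%N) (B (0, 4)%N) (B (0, 6)%N).
move: (B (1, 1)%N) (B (1, 3)%N) (B (1, 5)%N) (B (1, 6)%N).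
move: (B (2, 2)%N) (B (2, 3)%N) (B (2, 4)%N) (B (2, 5)%N).
by do 12!case.
Qed.

Section GroebnerBasis.

Variable K : numFieldType.
Local Notation P := {mpoly K[3 * 6]}.
Local Notation X := (var_mx K 3 6).
Local Notation qs_leads_to := (leads (wtab qs_weights)).

Definition det_terms_at t := det_terms (nth 0 t 0)%N (nth 0 t 1)%N (nth 0 t 2)%N.

Definition qs_at t : P := qs X (nth 0 t 0)%N (nth 0 t 1)%N (nth 0 t 2)%N.

Definition line_basis : seq (P * 'X_{1.. 3 * 6}) :=
  [seq (det_at X l.1, mon l.2) | l <- line_leads].

Definition qs_basis : seq (P * 'X_{1.. 3 * 6}) :=
  [seq (qs_at l.1, mon l.2) | l <- qs_leads].

Lemma det_leads t u : lead_check qs_weights (det_terms_at t) u ->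
  qs_leads_to (det_at X t) (mon u).
Proof. by rewrite /det_at -den_det; apply: lead_checkP. Qed.

Lemma qs_leadsP t u :
    lead_check qs_weights (qs_terms (nth 0 t 0)%N (nth 0 t 1)%N (nth 0 t 2)%N) u ->
  qs_leads_to (qs_at t) (mon u).
Proof. by rewrite /qs_at -den_qs; apply: lead_checkP. Qed.

Lemma line_basis_leads : all (fun t => qs_leads_to t.1 t.2) line_basis.
Proof.
rewrite all_map; apply/allP => l l_in; apply: det_leads; move: l l_in; apply/allP.
by vm_compute.
Qed.

Lemma qs_basis_leads : all (fun t => qs_leads_to t.1 t.2) qs_basis.
Proof.
rewrite all_map; apply/allP => l l_in; apply: qs_leadsP; move: l l_in; apply/allP.
by vm_compute.
Qed.

Lemma line_basis_coprime : pairwise (@mcoprime _) (unzip2 line_basis).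
Proof. by rewrite /= !mcoprime_mon. Qed.

Lemma path_lead_dvd (p : P) m t : vanishes_on_quadrilaterals p -> qs_leads_to p m ->
    t \in path_leads ->
  exists N, has_lead_dvd (line_basis) (mon t.2 *+ N + m)%MM.
Proof.
move=> p0 pm t_in.
have /and4P[s_aut s'_aut ss' t_lead] : [&& is_automorphism t.1.1, is_automorphism t.1.2,
    inverse_labels t.1.1 t.1.2 & lead_check qs_weights
      (det_terms_at (map (relabel t.1.1) [:: 4; 5; 1]%N)) t.2].
  by move: t t_in; apply/allP; vm_compute.
have [N sp] := path_ideal_relabel s_aut s'_aut ss' p0; exists N.
exact: (coprime_leads_dvdXM (@wtab_gt0 qs_weights) line_basis_leads line_basis_coprime
  (det_leads t_lead) pm sp).
Qed.

Lemma basis_lead_dvd (p : P) m : vanishes_on_quadrilaterals p -> qs_leads_to p m ->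
  has_lead_dvd (line_basis ++ qs_basis) m.
Proof.
(* [B] records which variables divide [m]. If a line lead divides a power of a path lead times [m],
   each of its variables divides the path lead or [m], which is the hypothesis of [colon_check]. *)
move=> p0 pm; pose B q := (0 < m (ix q))%N.
have : has (fun l => all B l.2) (line_leads ++ qs_leads).
  apply: colon_check; apply/allP => t t_in.
  have [N] := path_lead_dvd p0 pm t_in.
  rewrite /has_lead_dvd /line_basis has_map => /hasP[l l_in l_dvd]; apply/hasP; exists l => //.
  have /andP[rl ul] : in_range l.2 && uniq l.2.
    by move: l l_in {l_dvd}; apply/allP; vm_compute.
  have rt : in_range t.2 by move: t t_in {l_dvd}; apply/allP; vm_compute.
  move: l_dvd; rewrite /= mon_dvd // => /allP l_dvd; apply/allP=> q q_l.
  have rq : in_range (q :: t.2) by rewrite /= rt andbT (allP rl).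
  have := l_dvd q q_l; rewrite mnmDE mulmnE mon_ix // /B.
  by case: (boolP (q \in t.2)) => // /count_memPn->.
case/hasP=> l; rewrite mem_cat => l_in l_pos.
have l_dvd : (mon l.2 <= m)%MM.
  rewrite mon_dvd //; move: l_in {l_pos}; rewrite -mem_cat; move: l; apply/allP; by vm_compute.
rewrite /has_lead_dvd has_cat /line_basis /qs_basis !has_map.
by case/orP: l_in => l_in; apply/orP; [left | right]; apply/hasP; exists l.
Qed.

Lemma basis_vanishes g : g \in unzip1 (line_basis ++ qs_basis) ->
  vanishes_on_quadrilaterals g.
Proof.
move=> g_in A quadA; move: g_in; rewrite /unzip1 map_cat mem_cat eval_mxE.
case/orP=> /mapP[_ /mapP[l l_in ->] ->] /=; last first.
  by rewrite subst_qs quadrilateral_qs.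
rewrite subst_det3 -/(det_at A l.1); apply/eqP; move/quadrilateralP: quadA => quadA.
have /andP[l3 l_line] : (l.1 \in triples) && (l.1 \in lines).
  by move: l l_in; apply/allP; vm_compute.
by rewrite quadA.
Qed.

(** The normal form of [p] still vanishes on quadrilateral sets; were it nonzero, its lead would be
    divisible by one of the basis. *)
Lemma vanishes_span p : vanishes_on_quadrilaterals p ->
  ideal_span (unzip1 (line_basis ++ qs_basis)) p.
Proof.
move=> p0; have w0 := @wtab_gt0 qs_weights; set gs := line_basis ++ qs_basis.
have gsP : all (fun t => qs_leads_to t.1 t.2) gs.
  by rewrite all_cat line_basis_leads qs_basis_leads.
have [p' [pp' nf]] := normal_form w0 p gsP.
suff p'0 : p' = 0 by rewrite -(subr0 p) -p'0.
case: nf => // -[m p'm] /negP[]; apply: basis_lead_dvd p'm.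
have pp'0 : vanishes_on_quadrilaterals (p - p').
  apply: ideal_span_ind pp' => [A _|q r q0 r0 A quadA|q r r0 A quadA|q].
  - by rewrite /eval_mx meval0.
  - by rewrite /eval_mx mevalD -!/(eval_mx _ _) q0 ?r0 ?addr0.
  - by rewrite /eval_mx mevalM -!/(eval_mx _ _) r0 ?mulr0.
  - exact: basis_vanishes.
move=> A quadA; rewrite -[p'](subKr p) /eval_mx mevalB -!/(eval_mx _ _).
by rewrite p0 ?pp'0 ?subr0.
Qed.

End GroebnerBasis.

(** * Realizations of the matroid *)

Section Free.

Variable K : fieldType.

Lemma free_col3 (u v w : 'cV[K]_3) :
  free [:: u; v; w] = (\det (\matrix_(i < 3, j < 3) [:: u; v; w]`_j i 0) != 0).
Proof.
set X := [:: u; v; w]; set M := \matrix_(i, j) _.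
have MXE (k : 'rV[K]_3) : k *m M^T = (\sum_(i < 3) k 0 i *: X`_i)^T.
  apply/rowP => j; rewrite !mxE summxE; apply: eq_bigr => i _.
  by rewrite !mxE.
rewrite -det_tr; apply/idP/idP => [/(@freeP _ _ 3 (in_tuple X)) freeX|detM].
  apply/det0P => -[k k0 kM]; case/eqP: k0; apply/rowP => i; rewrite mxE.
  apply: (freeX (fun i => k 0 i)); apply: trmx_inj; rewrite trmx0 -kM MXE.
  by congr (_^T).
apply/(@freeP _ _ 3 (in_tuple X)) => k kX i; apply: contraNeq detM => ki0.
apply/det0P; exists (\row_j k j).
  by apply: contraNneq ki0 => /rowP/(_ i); rewrite !mxE => ->.
by rewrite MXE (eq_bigr (fun j : 'I_3 => k j *: X`_j)) ?kX ?trmx0 // => j _; rewrite mxE.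
Qed.

Lemma free_subseq (vT : vectType K) (s t : seq vT) : subseq s t -> free t -> free s.
Proof.
move=> /perm_to_subseq[r /perm_free->]; exact: catl_free.
Qed.

Lemma free_size (s : seq 'cV[K]_3) : free s -> (size s <= 3)%N.
Proof.
rewrite /free => /eqP <-; apply: leq_trans (dimvS (subvf _)) _.
by rewrite dimvf dim_matrix.
Qed.

End Free.

Section QSIndep.

Implicit Types (S D : {set 'I_6}) (t : seq nat).

Lemma QS_lines_card D : D \in QS_lines -> #|D| = 3%N.
Proof.
have card3 a b c : a \notin [:: b; c] -> b != c -> #|[set a; b; c] : {set 'I_6}| = 3%N.
  rewrite !inE negb_or => /andP[ab ac] bc.
  by rewrite -setUA cardsU1 cards2 !inE negb_or ab ac bc.
have pt_neq a b : (0 < a <= 6)%N -> (0 < b <= 6)%N -> a != b -> pt a != pt b.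
  move=> /andP[a0 a6] /andP[b0 b6]; apply: contraNneq => /(congr1 (@nat_of_ord 6)).
  rewrite /pt !inordK ?prednK // => ab.
  by rewrite -(prednK a0) ab prednK.
by rewrite !inE -!orbA => /or4P[]/eqP->; rewrite card3 ?inE ?negb_or ?pt_neq.
Qed.

(** Containing a circuit is the same as containing any line or 4-set, and a set of at most three
    labels contains a line only by being one. *)
Lemma QS_indepE S : QS_indep S = (#|S| <= 3)%N && (S \notin QS_lines).
Proof.
pose Q D := (D \in QS_lines) || (#|D| == 4)%N.
have -> : QS_indep S = ~~ [exists D, Q D && (D \subset S)].
  apply/forall_inP/existsPn => [indS D|noD C].
    apply/negP => /andP[QD DS]; have [C minC CD] := minset_exists QD.
    by have := indS C; rewrite inE minC (subset_trans CD DS) => /(_ isT).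
  by rewrite inE => /minsetp QC; have := noD C; rewrite /Q QC.
rewrite -[RHS]negbK; congr (~~ _); rewrite negb_and negbK -ltnNge.
apply/existsP/orP => [[D /andP[/orP[D_line|/eqP D4] DS]]|[S4|S_line]].
- have [S4|S3] := ltnP 3 #|S|; [by left | right].
  have /eqP <- // : D == S by rewrite eqEcard DS (QS_lines_card D_line).
- by left; move: (subset_leq_card DS); rewrite D4.
- exists [set x in take 4 (enum S)]; apply/andP; split.
    apply/orP; right; rewrite cardsE (card_uniqP _) ?take_uniq ?enum_uniq //.
    by rewrite size_takel // -cardE.
  by apply/subsetP => x; rewrite inE => /mem_take; rewrite mem_enum.
- by exists S; rewrite /Q S_line subxx.
Qed.

End QSIndep.
Section Realizations.

Implicit Types (S : {set 'I_6}) (t : seq nat).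

Definition label_set t : {set 'I_6} := [set x in map pt t].

Lemma val_pt k : (0 < k <= 6)%N -> pt k = k.-1 :> nat.
Proof. by case/andP=> k0 k6; rewrite /pt inordK // prednK. Qed.

Lemma val_pt_triple t : t \in triples -> map val (map pt t) = map predn t.
Proof.
move=> t3; rewrite -map_comp; apply/eq_in_map => k k_t /=.
have /andP[_ /allP labels_t] := triples_labels3 t3.
exact: val_pt (labels_t _ k_t).
Qed.

Lemma enum_sorted S : sorted ltn (map val (enum S)).
Proof.
apply: (subseq_sorted ltn_trans) (iota_ltn_sorted 0 6); rewrite -val_enum_ord.
by apply: map_subseq; rewrite enumT; apply: filter_subseq.
Qed.

Lemma enum_label_set t : t \in triples -> enum (label_set t) = map pt t.
Proof.
move=> t3; apply: (inj_map val_inj); apply: (irr_sorted_eq ltn_trans ltnn).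
- exact: enum_sorted.
- rewrite val_pt_triple //; move: t t3; apply/allP; by vm_compute.
- move=> k; apply/mapP/mapP => -[x x_in ->]; exists x => //.
    by move: x_in; rewrite mem_enum inE.
  by rewrite mem_enum inE.
Qed.

Lemma mem_QS_lines t : t \in triples -> (label_set t \in QS_lines) = (t \in lines).
Proof.
move=> t3; have set3 a b c : [set pt a; pt b; pt c] = label_set [:: a; b; c].
  by apply/setP => x; rewrite !inE orbA.
have -> : (label_set t \in QS_lines) = (label_set t \in map label_set lines).
  by rewrite !inE !set3 -!orbA.
apply/mapP/idP => [[l l_line /(congr1 (fun S : {set _} => map val (enum S)))]|]; last by exists t.
have l3 : l \in triples by move: l l_line; apply/allP.
rewrite !enum_label_set // !val_pt_triple // => tl; suff -> : t = l by [].
have predK u : u \in triples -> map (succn \o predn) u = u.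
  move=> u3; rewrite -[RHS]map_id; apply/eq_in_map => k k_u /=; apply: prednK.
  by have /andP[_ /allP/(_ k k_u)/andP[]] := triples_labels3 u3.
by apply: etrans (esym (predK _ t3)) _; rewrite map_comp tl -map_comp predK.
Qed.

Variable K : fieldType.
Implicit Type A : 'M[K]_(3, 6).

Lemma free_cols A t : size t = 3%N ->
  free [seq col j A | j <- map pt t] = (det_at A t != 0).
Proof.
case: t => [|a [|b [|c [|//]]]] // _; rewrite free_col3 det_col3.
by rewrite /det_at /det3 /ent !mxE.
Qed.

Lemma mem_triples a b c : (a < b < c)%N -> (c < 6)%N -> [:: a.+1; b.+1; c.+1] \in triples.
Proof.
move=> /andP[ab bc] c6; have b6 := ltn_trans bc c6; have a6 := ltn_trans ab b6.
have /allP/(_ a) : all (fun a => all (fun b => all (fun c => (a < b)%N ==> (b < c)%N ==>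
    ([:: a.+1; b.+1; c.+1] \in triples)) (iota 0 6)) (iota 0 6)) (iota 0 6) by vm_compute.
rewrite mem_iota => /(_ a6)/allP/(_ b); rewrite mem_iota => /(_ b6)/allP/(_ c).
by rewrite mem_iota => /(_ c6); rewrite ab bc.
Qed.

Lemma labels_of_card3 S : #|S| = 3%N -> exists2 t, t \in triples & enum S = map pt t.
Proof.
rewrite cardE => S3; have := enum_sorted S; case: (enum S) S3 => [|x [|y [|z [|//]]]] // _.
move=> /= /and3P[xy yz _]; exists [:: x.+1; y.+1; z.+1].
  by apply: mem_triples; rewrite ?xy ?ltn_ord.
by congr [:: _; _; _]; apply/val_inj; rewrite /= val_pt //= ltn_ord.
Qed.

Lemma realizes_quadrilateral A : realizes QS_indep A -> quadrilateral A.
Proof.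
move=> realA; apply/quadrilateralP => t t3; have /andP[/eqP size_t _] := triples_labels3 t3.
have := realA (label_set t); rewrite enum_label_set // free_cols // QS_indepE.
rewrite cardE enum_label_set // size_map size_t mem_QS_lines //= => /negbRL->.
by rewrite negbK.
Qed.

Lemma quadrilateral_realizes A : quadrilateral A -> realizes QS_indep A.
Proof.
move=> /quadrilateralP quadA S; rewrite QS_indepE.
have [S4|] := ltnP 3 #|S|.
  by apply: contraTF S4 => /free_size; rewrite size_map -cardE leqNgt.
rewrite leq_eqVlt => /predU1P[S3|S2].
  have [t t3 St] := labels_of_card3 S3; have /andP[/eqP size_t _] := triples_labels3 t3.
  rewrite St free_cols // quadA // -mem_QS_lines // (_ : label_set t = S) //.
  by apply/setP => x; rewrite inE -St mem_enum.
rewrite (_ : S \notin QS_lines) /=; last first.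
  by apply: contraTN S2 => /QS_lines_card->.
(* A set of at most two labels extends to a triple that is not a line, whose columns are free. *)
suff [t t3 [t_line sub_t]] : exists2 t, t \in triples & t \notin lines /\ {subset enum S <= map pt t}.
  have /andP[/eqP size_t _] := triples_labels3 t3.
  apply: (@free_subseq _ _ _ [seq col j A | j <- map pt t]); last by rewrite free_cols // quadA.
  apply: map_subseq; rewrite -enum_label_set //.
  have -> : enum S = [seq x <- enum (label_set t) | x \in S]; last exact: filter_subseq.
  rewrite /enum_mem -filter_predI; apply: eq_filter => x /=.
  case: (boolP (x \in S)) => //= x_S.
  by rewrite -[RHS]/(x \in label_set t) inE sub_t ?mem_enum.
have pair_check (x y : 'I_6) : exists2 t, t \in triples &
    [/\ t \notin lines, x \in map pt t & y \in map pt t].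
  have : has (fun t => [&& t \notin lines, x.+1 \in t & y.+1 \in t]) triples.
    have /allP/(_ x.+1) : all (fun a => all (fun b => has (fun t => [&& t \notin lines, a \in t &
      b \in t]) triples) (iota 1 6)) (iota 1 6) by vm_compute.
    have label_ord (z : 'I_6) : z.+1 \in iota 1 6.
      by rewrite mem_iota /= add1n ltnS ltn_ord.
    by move=> /(_ (label_ord x))/allP/(_ y.+1 (label_ord y)).
  have ptK (z : 'I_6) : pt z.+1 = z by apply/val_inj; rewrite /= val_pt //= ltn_ord.
  case/hasP=> t t3 /and3P[t_line x_t y_t]; exists t => //.
  by split=> //; [rewrite -(ptK x) | rewrite -(ptK y)]; rewrite map_f.
move: S2; rewrite cardE; case: (enum S) => [|x [|y [|//]]] _.
- by exists [:: 1; 2; 4]%N.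
- have [t t3 [t_line x_t _]] := pair_check x x; exists t => //; split=> // z.
  by rewrite inE => /eqP->.
- have [t t3 [t_line x_t y_t]] := pair_check x y; exists t => //; split=> // z.
  by rewrite !inE => /orP[]/eqP->.
Qed.

End Realizations.

(** * Generators *)

Section Generators.

Variable K : fieldType.
Local Notation P := {mpoly K[3 * 6]}.
Local Notation X := (var_mx K 3 6).
Local Notation gens := (QS_generators K).

Definition sorted_triples : seq ('I_3 * 'I_3 * 'I_3) :=
  [seq t : 'I_3 * 'I_3 * 'I_3 <- enum {: 'I_3 * 'I_3 * 'I_3} | (t.1.1 <= t.1.2 <= t.2)%N].

Lemma QS_generatorsE : gens = line_dets K ++
  [seq qs X t.1.1 t.1.2 t.2 | t : 'I_3 * 'I_3 * 'I_3 <- sorted_triples].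
Proof.
rewrite /QS_generators !bracketXE; congr (_ ++ _).
by apply: eq_map => t; rewrite QS_polyE.
Qed.

Lemma line_det_gens l : l \in lines -> ideal_span gens (det_at X l).
Proof.
by move=> l_line; apply: mem_ideal_span; rewrite QS_generatorsE mem_cat map_f.
Qed.

Lemma qs_gens i j k : (i <= j <= k)%N -> (k < 3)%N -> ideal_span gens (qs X i j k).
Proof.
move=> /andP[ij jk] k3; have j3 := leq_ltn_trans jk k3; have i3 := leq_ltn_trans ij j3.
apply: mem_ideal_span; rewrite QS_generatorsE mem_cat; apply/orP; right.
apply/mapP; exists (inord i, inord j, inord k); last by rewrite /= !inordK.
by rewrite mem_filter mem_enum /= !inordK // ij jk.
Qed.

Lemma qs_leads_gens l : l \in qs_leads ->
  ideal_span gens (qs X (nth 0 l.1 0)%N (nth 0 l.1 1)%N (nth 0 l.1 2)%N).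
Proof.
have d123 c : ideal_span gens (c * det3 X 1 2 3).
  exact/ideal_spanM/(@line_det_gens [:: 1; 2; 3]%N).
have d156 c : ideal_span gens (c * det3 X 1 5 6).
  exact/ideal_spanM/(@line_det_gens [:: 1; 5; 6]%N).
have d246 c : ideal_span gens (c * det3 X 2 4 6).
  exact/ideal_spanM/(@line_det_gens [:: 2; 4; 6]%N).
have d345 c : ideal_span gens (c * det3 X 3 4 5).
  exact/ideal_spanM/(@line_det_gens [:: 3; 4; 5]%N).
rewrite /qs_leads !inE; do 9?[case/predU1P=> [->|]]; last move/eqP->; try exact: qs_gens.
- rewrite [nth _ _ 0]/= [nth _ _ 1]/= [nth _ _ 2]/= qs_swap021.
  have q012 : ideal_span gens (qs X 0 1 2) by apply: qs_gens.
  exact: ideal_spanB (ideal_spanD (ideal_spanD (ideal_spanD q012 (d246 _)) (d345 _))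
    (d123 _)) (d156 _).
- rewrite [nth _ _ 0]/= [nth _ _ 1]/= [nth _ _ 2]/= qs_swap101.
  have q011 : ideal_span gens (qs X 0 1 1) by apply: qs_gens.
  exact: ideal_spanB (ideal_spanD (ideal_spanB (ideal_spanB q011 (d156 _)) (d246 _))
    (d123 _)) (d345 _).
- rewrite [nth _ _ 0]/= [nth _ _ 1]/= [nth _ _ 2]/= qs_swap121.
  have q112 : ideal_span gens (qs X 1 1 2) by apply: qs_gens.
  exact: ideal_spanB (ideal_spanD (ideal_spanD (ideal_spanD q112 (d246 _)) (d345 _))
    (d123 _)) (d156 _).
Qed.

Lemma gens_vanish (A : 'M[K]_(3, 6)) : quadrilateral A ->
  forall p, ideal_span gens p -> eval_mx A p = 0.
Proof.
move=> quadA; apply: (ideal_span_ind (I := fun p => eval_mx A p = 0)).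
- exact: meval0.
- by move=> p q pA qA; rewrite /eval_mx mevalD -!/(eval_mx _ _) pA qA addr0.
- by move=> p q qA; rewrite /eval_mx mevalM -!/(eval_mx _ _) qA mulr0.
move=> p; rewrite QS_generatorsE mem_cat => /orP[]/mapP[t t_in ->]; last first.
  by rewrite [eval_mx _ _]subst_qs quadrilateral_qs.
rewrite [eval_mx _ _]subst_det3 -/(det_at A t); apply/eqP.
have t3 : t \in triples by move: t t_in; apply/allP.
by move/quadrilateralP: quadA => /(_ t t3)->.
Qed.

End Generators.

(** * Minimality of the generators *)

Section Minimality.

Variable K : fieldType.
Local Notation P := {mpoly K[3 * 6]}.
Local Notation X := (var_mx K 3 6).
Local Notation gens := (QS_generators K).

Definition point_of_line (l : seq nat) : 'M[K]_(3, 6) :=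
  mx36 (fun i k => if k \in l then (i == index k l)%:R else 0).

(** The three pairs in each product of a QS polynomial partition the six labels, so one of them
    meets a zero column. *)
Lemma qs_point_of_line l i j k : l \in lines -> qs (point_of_line l) i j k = 0.
Proof.
have mod3 n : (n %% 3 < 3)%N by rewrite ltn_mod.
by rewrite /lines !inE => /or4P[]/eqP->; rewrite /qs /cross !ent_mx36 //= ?mod3 //; ring.
Qed.

Lemma det_point_of_line l l' : l \in lines -> l' \in lines ->
  det_at (point_of_line l) l' = (l == l')%:R.
Proof.
rewrite /lines !inE => /or4P[]/eqP-> /or4P[]/eqP->;
  by rewrite /det_at /det3 !ent_mx36 //=; ring.
Qed.

Lemma not_span_line i : (i < 4)%N -> ~ ideal_span (remove_nth i gens) (nth 0 gens i).
Proof.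
move=> i4 in_span; set l := nth [::] lines i.
have l_line : l \in lines by apply: mem_nth.
have nthE : nth 0 gens i = det_at X l by rewrite QS_generatorsE nth_cat size_map i4 (nth_map [::]).
suff : eval_mx (point_of_line l) (nth 0 gens i) = 0.
  rewrite nthE [eval_mx _ _]subst_det3 -/(det_at _ l) det_point_of_line // eqxx.
  by move/eqP; rewrite oner_eq0.
move: in_span; apply: (ideal_span_ind (I := fun p => eval_mx (point_of_line l) p = 0)).
- exact: meval0.
- by move=> p q pA qA; rewrite /eval_mx mevalD -!/(eval_mx _ _) pA qA addr0.
- by move=> p q qA; rewrite /eval_mx mevalM -!/(eval_mx _ _) qA mulr0.
move=> p; rewrite QS_generatorsE /remove_nth take_cat drop_cat size_map i4.
have lineE l' : l' \in lines -> l != l' -> eval_mx (point_of_line l) (det_at X l') = 0.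
  move=> l'_line ll'; rewrite [eval_mx _ _]subst_det3 -/(det_at _ l').
  by rewrite det_point_of_line // (negPf ll').
rewrite mem_cat => /orP[].
  rewrite -map_take => /mapP[l' l'_in ->]; apply: lineE; first exact: mem_take l'_in.
  apply: contraTneq l'_in => <-; rewrite /l; move: i i4 {l l_line nthE}.
  by do 4?case=> //.
have qsE q : q \in [seq qs X t.1.1 t.1.2 t.2 | t : 'I_3 * 'I_3 * 'I_3 <- sorted_triples] ->
    eval_mx (point_of_line l) q = 0.
  by case/mapP=> t _ ->; rewrite [eval_mx _ _]subst_qs qs_point_of_line.
case: ifP => _; last by move/mem_drop; exact: qsE.
rewrite mem_cat => /orP[|/qsE //].
rewrite -map_drop => /mapP[l' l'_in ->]; apply: lineE; first exact: mem_drop l'_in.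
apply: contraTneq l'_in => <-; rewrite /l; move: i i4 {l l_line nthE qsE}.
by do 4?case=> //.
Qed.

(* The matrix has rank 2, so the brackets of lines vanish on it, and its columns span
   the plane with Pluecker coordinates (1, 'X, 'X^4); the exponents 0, 1, 4 make the
   cubic monomials in these coordinates distinct powers of 'X. The factor 'X^13
   separates the constant terms of the coefficients from the other ones. *)
Definition plane_mx : 'M[{poly K}]_(3, 6) := mx36 (fun i k =>
  'X^13 * ([:: - 'X; 1; 0]`_i + [:: 0; 0; 1; 1; 0; 1]`_k.-1 * [:: - 'X^4; 0; 1]`_i)).

Local Notation psi := (subst (@polyC K) plane_mx).

Definition row_exp (i : nat) : nat := nth 0%N [:: 0; 1; 4]%N i.

Definition triple_exp (t : 'I_3 * 'I_3 * 'I_3) : nat :=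
  (row_exp t.1.1 + row_exp t.1.2 + row_exp t.2)%N.

Lemma det_plane_mx l : l \in lines -> det_at plane_mx l = 0.
Proof.
by rewrite /lines !inE => /or4P[]/eqP->; rewrite /det_at /det3 !ent_mx36 //=; ring.
Qed.

Lemma qs_plane_mx (t : 'I_3 * 'I_3 * 'I_3) : qs plane_mx t.1.1 t.1.2 t.2 = 'X^(78 + triple_exp t).
Proof.
(* Columns 1, 2, 5 coincide, and so do 3, 4, 6. Hence the cross product of 1 and 5 vanishes, and the
   signs 1, 1, -1 in the second product cancel the minus before it. The exponent 78 is three times
   26. *)
have crossE a b (i : 'I_3) : (0 < a <= 6)%N -> (0 < b <= 6)%N ->
    cross plane_mx a b i = 'X^26 * 'X^(row_exp i) *
      ([:: 0; 0; 1; 1; 0; 1]`_b.-1 - [:: 0; 0; 1; 1; 0; 1]`_a.-1).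
  move=> ra rb; rewrite /cross; case: i => -[|[|[|//]]] i3; rewrite !ent_mx36 //= ?ra ?rb //;
    by rewrite /row_exp /=; ring.
rewrite /qs !crossE //= /triple_exp !exprD; ring.
Qed.

(** All entries of [plane_mx] are divisible by ['X^13], so an image under [psi] is a constant plus a
    multiple of ['X^13]. *)
Lemma psi_gap c j : (0 < j < 13)%N -> (psi c)`_j = 0.
Proof.
elim/mpoly_ring_ind: c j => [c|k|p q pE qE|p q pE qE] j /andP[j0 j13].
- by rewrite substC coefC gtn_eqF.
- case/mxvec_indexP: k => i k; rewrite substX mxE coefXnM j13 //.
- by rewrite substD coefD pE ?qE ?addr0 ?j0.
rewrite substM coefM big1 // => -[[|i] ij] _ /=; first by rewrite subn0 qE ?mulr0 ?j0.
by rewrite pE ?mul0r //= (leq_trans _ j13).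
Qed.

Lemma triple_exp_le t : (triple_exp t <= 12)%N.
Proof. by case: t => [[[i i3] [j j3]] [k k3]]; move: i j k i3 j3 k3; do 3![case=> [|[|[|//]]]]. Qed.

(** The exponent is the number of indices 1 plus four times the number of indices 2. Both numbers
    are at most 3, so they are base 4 digits, and they determine a sorted triple. *)
Lemma triple_exp_inj t t' : t \in sorted_triples -> t' \in sorted_triples ->
  triple_exp t = triple_exp t' -> t = t'.
Proof.
rewrite !mem_filter => /andP[st _] /andP[st' _].
case: t t' st st' => [[i j] k] [[i' j'] k'] /=; rewrite /triple_exp /row_exp /=.
case: i => -[|[|[|//]]] i3; case: j => -[|[|[|//]]] j3 //; case: k => -[|[|[|//]]] k3 // _;
case: i' => -[|[|[|//]]] i'3; case: j' => -[|[|[|//]]] j'3 //; case: k' => -[|[|[|//]]] k'3 // _ //= _;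
by congr (_, _, _); apply/val_inj.
Qed.

(** Compare coefficients of ['X^e] in the image under [psi]. A multiple of another QS polynomial
    contributes a coefficient of [psi c] at a nonzero distance of at most 12, which lies in the
    gap. *)
Lemma not_span_qs t s : t \in sorted_triples -> {subset s <= sorted_triples} -> t \notin s ->
  ~ ideal_span (line_dets K ++ [seq qs X t.1.1 t.1.2 t.2 | t : 'I_3 * 'I_3 * 'I_3 <- s])
      (qs X t.1.1 t.1.2 t.2).
Proof.
move=> t_in s_sub t_s in_span; pose e := (78 + triple_exp t)%N.
suff : forall c, (psi (c * qs X t.1.1 t.1.2 t.2))`_e = 0.
  move/(_ 1); rewrite mul1r subst_qs qs_plane_mx coefXn eqxx.
  by move/eqP; rewrite oner_eq0.
move: in_span; apply: (ideal_span_ind (I := fun p => forall c, (psi (c * p))`_e = 0)).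
- by move=> c; rewrite mulr0 /subst mmap0 coef0.
- by move=> p q pE qE c; rewrite mulrDr substD coefD pE qE addr0.
- by move=> p q qE c; rewrite mulrA qE.
move=> p; rewrite mem_cat => /orP[]/mapP[t' t'_in ->] c; rewrite substM.
  by rewrite subst_det3 -/(det_at _ t') det_plane_mx // mulr0 coef0.
rewrite subst_qs qs_plane_mx coefMXn; case: ltnP => // le_e.
apply: psi_gap; rewrite subn_gt0 ltn_neqAle le_e andbT; apply/andP; split.
  apply: contraNneq t_s => /addnI/triple_exp_inj <- //; exact: s_sub.
rewrite subnDl ltn_subLR ?ltn_addl ?ltnS ?triple_exp_le //.
Qed.

Lemma generators_minimal i : (i < size gens)%N ->
  ~ ideal_span (remove_nth i gens) (nth 0 gens i).
Proof.
have [i4 _|i4] := ltnP i 4; first exact: not_span_line.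
have size4 : size (line_dets K) = 4%N by [].
have t0 : 'I_3 * 'I_3 * 'I_3 := (ord0, ord0, ord0).
rewrite QS_generatorsE size_cat size4 size_map -ltn_subLR // => lt_i.
have i4F : (i < 4)%N = false by rewrite ltnNge i4.
have Si4F : (i.+1 < 4)%N = false by rewrite ltnNge (leqW i4).
rewrite /remove_nth nth_cat take_cat drop_cat size4 i4F Si4F.
rewrite (nth_map t0) // -map_take subSn // -map_drop -catA -map_cat.
set j := (i - 4)%N in lt_i *; set t := nth t0 sorted_triples j.
have uniq_L : uniq sorted_triples by rewrite filter_uniq ?enum_uniq.
apply: not_span_qs; first exact: mem_nth.
  by move=> x; rewrite mem_cat => /orP[/mem_take|/mem_drop].
move: uniq_L; rewrite -{1}(cat_take_drop j sorted_triples) (drop_nth t0) // -/t.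
by rewrite -cat1s uniq_catCA /= => /andP[].
Qed.

End Minimality.

Theorem theorem4p8 (R : realType) :
  (forall p : {mpoly R[i][3 * 6]},
      @matroid_ideal R[i] 3 6 QS_indep p <-> ideal_span (QS_generators R[i]) p)
  /\ (forall i : nat, (i < size (QS_generators R[i]))%N ->
        ~ ideal_span (remove_nth i (QS_generators R[i]))
                     (nth 0 (QS_generators R[i]) i)).
Proof.
split=> [p|]; last exact: generators_minimal.
split=> [p_in|p_span A closA].
  have p0 : vanishes_on_quadrilaterals p.
    move=> A quadA; apply: p_in => F F0; apply: F0.
    exact: quadrilateral_realizes.
  apply: sub_ideal_span (vanishes_span p0) => g.
  rewrite /unzip1 map_cat mem_cat => /orP[]/mapP[_ /mapP[l l_in ->] ->] /=.
    apply: line_det_gens; move: l l_in; apply/allP; by vm_compute.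
  exact: qs_leads_gens.
(* Among the algebraic sets in the definition of the closure is the zero locus of [p] alone. *)
apply: (closA (eq p)) => // B realB _ <-.
exact: gens_vanish (realizes_quadrilateral realB) _ p_span.
Qed.
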